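(* Let $n\ge 7$. The Stiefel manifold $V_5\mathbb{R}^n=\mathrm{SO}(n)/\mathrm{SO}(n-5)$ admits at least six $\mathrm{SO}(n)$-invariant Einstein metrics, pairwise distinct up to multiplication by a positive constant. Among them, two are Jensen's metrics; two others are given by $\mathrm{Ad}(\mathrm{SO}(4)\times\mathrm{SO}(n-5))$-invariant scalar products on $\mathfrak{p}$ of the form $$x_2\,(-B)|_{\mathfrak{so}(4)}+x_{12}\,(-B)|_{\mathfrak{m}_{12}}+x_{13}\,(-B)|_{\mathfrak{m}_{13}}+x_{23}\,(-B)|_{\mathfrak{m}_{23}},\qquad x_2,x_{12},x_{13},x_{23}>0,$$ relative to the block decomposition with $(k_1,k_2,k_3)=(1,4,n-5)$; and the remaining two are given by $\mathrm{Ad}(\mathrm{SO}(2)\times\mathrm{SO}(3)\times\mathrm{SO}(n-5))$-invariant scalar products on $\mathfrak{p}$ of the form $$x_1\,(-B)|_{\mathfrak{so}(2)}+x_2\,(-B)|_{\mathfrak{so}(3)}+x_{12}\,(-B)|_{\mathfrak{m}_{12}}+x_{13}\,(-B)|_{\mathfrak{m}_{13}}+x_{23}\,(-B)|_{\mathfrak{m}_{23}},\qquad x_1,x_2,x_{12},x_{13},x_{23}>0,$$ relative to the block decomposition with $(k_1,k_2,k_3)=(2,3,n-5)$.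
   Context: A Riemannian metric $g$ is Einstein if $\mathrm{Ric}_g=\lambda g$ for some constant $\lambda\in\mathbb{R}$. $V_5\mathbb{R}^n=G/H$ with $G=\mathrm{SO}(n)$ and $H=\mathrm{SO}(n-5)$ embedded as the lower right $(n-5)\times(n-5)$ block. $B$ is the Killing form of $\mathfrak{so}(n)$, so $-B$ is an $\mathrm{Ad}(G)$-invariant inner product, and $\mathfrak{p}$ is the $(-B)$-orthogonal complement of $\mathfrak{so}(n-5)$ in $\mathfrak{so}(n)$, identified with the tangent space of $G/H$ at $eH$. $G$-invariant Riemannian metrics on $G/H$ correspond to $\mathrm{Ad}(H)$-invariant inner products on $\mathfrak{p}$. A sum such as $\sum_i x_i(-B)|_{V_i}$ denotes the inner product for which the subspaces $V_i$ are mutually orthogonal and which equals $x_i(-B)$ on $V_i$. Block decomposition: for $k_1+k_2+k_3=n$ with $k_3=n-5$, write skew-symmetric $n\times n$ matrices in blocks of sizes $k_1,k_2,k_3$. Let $\mathfrak{so}(k_i)$ be the subalgebra of matrices supported in the $i$-th diagonal block, and for $i<j$ let $\mathfrak{m}_{ij}$ be the subspace of skew-symmetric matrices whose only nonzero blocks are the $(i,j)$ block $A_{ij}$ (an arbitrary real $k_i\times k_j$ matrix) and the $(j,i)$ block $-A_{ij}^{t}$. Then $\mathfrak{p}=\mathfrak{so}(k_1)\oplus\mathfrak{so}(k_2)\oplus\mathfrak{m}_{12}\oplus\mathfrak{m}_{13}\oplus\mathfrak{m}_{23}$, where $\mathfrak{so}(k_1)=0$ if $k_1=1$. The group $\mathrm{SO}(k_1)\times\mathrm{SO}(k_2)\times\mathrm{SO}(k_3)$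 is embedded block-diagonally in $\mathrm{SO}(n)$ (with $\mathrm{SO}(1)$ trivial). Jensen's metrics: let $\mathfrak{so}(5)\subset\mathfrak{p}$ be the subalgebra supported in the upper left $5\times5$ block, and let $\mathfrak{q}$ be its $(-B)$-orthogonal complement in $\mathfrak{p}$. Jensen's metrics on $V_5\mathbb{R}^n$ are, up to scale, the two invariant metrics given by the inner products $a\,(-B)|_{\mathfrak{so}(5)}+(-B)|_{\mathfrak{q}}$ with $$a=\frac{n-2\pm\sqrt{n^2-7n+7}}{n-1}.$$ In terms of the block decomposition with $(k_1,k_2,k_3)=(1,4,n-5)$ this is $x_2=x_{12}=a$, $x_{13}=x_{23}=1$; with $(k_1,k_2,k_3)=(2,3,n-5)$ it is $x_1=x_2=x_{12}=a$, $x_{13}=x_{23}=1$. *)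

(* Defs.v *)
From mathcomp Require Import all_boot all_order all_algebra.
From mathcomp Require Import reals.
From mathcomp Require Import ring.

Set Implicit Arguments.
Unset Strict Implicit.
Unset Printing Implicit Defensive.

Import Order.TTheory GRing.Theory Num.Theory.

Local Open Scope ring_scope.

(* Rows and columns are numbered from 0, so the lower right (n-5) x (n-5)    *)
(* block is the one with indices 5 <= i.                                     *)

Definition bracket (R : realType) (n : nat) (X Y : 'M[R]_n) : 'M[R]_n :=
  X *m Y - Y *m X.

Definition in_so (R : realType) (n : nat) (X : 'M[R]_n) : Prop := X^T = - X.

Definition in_so_on (R : realType) (n : nat) (S : pred 'I_n) (X : 'M[R]_n) :
    Prop :=
  in_so X /\ forall i j, ~~ (S i && S j) -> X i j = 0.

Definition skew_delta (R : realType) (n : nat) (i j : 'I_n) : 'M[R]_n :=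
  delta_mx i j - delta_mx j i.

(* Trace of a linear endomorphism f of the space of skew-symmetric matrices  *)
(* supported in the symmetric relation P: the matrices skew_delta i j with   *)
(* i < j and P i j are a basis, and the coordinate of X along skew_delta i j *)
(* is X i j; see skew_expansion.                                             *)
Definition trace_on (R : realType) (n : nat) (P : rel 'I_n)
    (f : 'M[R]_n -> 'M[R]_n) : R :=
  \sum_(i < n) \sum_(j < n | (i < j)%N && P i j) f (skew_delta R i j) i j.

(* B(X, Y) = tr (ad X o ad Y) on so(n). *)
Definition killing (R : realType) (n : nat) (X Y : 'M[R]_n) : R :=
  trace_on (fun _ _ => true) (fun Z => bracket X (bracket Y Z)).

Definition lower (n : nat) : pred 'I_n := fun i => (5 <= i)%N.

Definition in_h (R : realType) (n : nat) (X : 'M[R]_n) : Prop :=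
  in_so_on (@lower n) X.

Definition in_p (R : realType) (n : nat) (X : 'M[R]_n) : Prop :=
  in_so X /\ forall Y, in_h Y -> killing X Y = 0.

(* The projections of so(n) along so(n) = so(n-5) + p; see in_pP, pr_p_in_p  *)
(* and pr_h_in_h.                                                            *)
Definition pr_p (R : realType) (n : nat) (X : 'M[R]_n) : 'M[R]_n :=
  \matrix_(i, j) (if lower i && lower j then 0 else X i j).

Definition pr_h (R : realType) (n : nat) (X : 'M[R]_n) : 'M[R]_n := X - pr_p X.

Definition trace_p (R : realType) (n : nat) (f : 'M[R]_n -> 'M[R]_n) : R :=
  trace_on (fun i j => ~~ (lower i && lower j)) f.

(* The special orthogonal group of the coordinates in S, extended by the     *)
(* identity on the other coordinates.                                        *)
Definition SO_on (R : realType) (n : nat) (S : pred 'I_n) (A : 'M[R]_n) :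
    Prop :=
  [/\ A *m A^T = 1%:M, \det A = 1
    & forall i j, ~~ (S i && S j) -> A i j = (i == j)%:R].

Definition in_H (R : realType) (n : nat) (A : 'M[R]_n) : Prop :=
  SO_on (@lower n) A.

Definition Ad (R : realType) (n : nat) (A X : 'M[R]_n) : 'M[R]_n :=
  A *m X *m invmx A.

(* An SO(n)-invariant Riemannian metric is given by its value at eH, an      *)
(* Ad(H)-invariant inner product on p. Only the values of Q on p matter.     *)

Record inner_product_on_p (R : realType) (n : nat)
    (Q : 'M[R]_n -> 'M[R]_n -> R) : Prop := {
  ip_linear : forall (a : R) (X Y Z : 'M[R]_n), in_p X -> in_p Y -> in_p Z ->
    Q (a *: X + Y) Z = a * Q X Z + Q Y Z;
  ip_sym : forall X Y, in_p X -> in_p Y -> Q X Y = Q Y X;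
  ip_pos : forall X, in_p X -> X != 0 -> 0 < Q X X
}.

Definition Ad_invariant (R : realType) (n : nat) (K : 'M[R]_n -> Prop)
    (Q : 'M[R]_n -> 'M[R]_n -> R) : Prop :=
  forall A X Y, K A -> in_p X -> in_p Y -> Q (Ad A X) (Ad A Y) = Q X Y.

Definition invariant_metric (R : realType) (n : nat)
    (Q : 'M[R]_n -> 'M[R]_n -> R) : Prop :=
  inner_product_on_p Q /\ Ad_invariant (@in_H R n) Q.

Definition homothetic (R : realType) (n : nat)
    (Q1 Q2 : 'M[R]_n -> 'M[R]_n -> R) : Prop :=
  exists2 c : R, 0 < c & forall X Y, in_p X -> in_p Y -> Q1 X Y = c * Q2 X Y.

(* By Nomizu's theorem (Kobayashi-Nomizu II, Ch. X, Thm 2.1 and Prop. 2.3),  *)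
(* the invariant affine connections on a reductive homogeneous space G/H     *)
(* with g = h + p are the Ad(H)-equivariant bilinear maps L : p x p -> p,    *)
(* and their torsion and curvature at eH are                                 *)
(*   T(X, Y) = L(X)Y - L(Y)X - [X, Y]_p,                                     *)
(*   R(X, Y)Z = L(X)L(Y)Z - L(Y)L(X)Z - L([X, Y]_p)Z - [[X, Y]_h, Z].        *)
(* The Levi-Civita connection is the one that is torsion free and metric.    *)
Record levi_civita (R : realType) (n : nat) (Q : 'M[R]_n -> 'M[R]_n -> R)
    (L : 'M[R]_n -> 'M[R]_n -> 'M[R]_n) : Prop := {
  lc_in_p : forall X Y, in_p X -> in_p Y -> in_p (L X Y);
  lc_linear_l : forall (a : R) (X Y Z : 'M[R]_n),
    in_p X -> in_p Y -> in_p Z -> L (a *: X + Y) Z = a *: L X Z + L Y Z;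
  lc_linear_r : forall (a : R) (X Y Z : 'M[R]_n),
    in_p X -> in_p Y -> in_p Z -> L X (a *: Y + Z) = a *: L X Y + L X Z;
  lc_equivariant : forall A X Y, in_H A -> in_p X -> in_p Y ->
    L (Ad A X) (Ad A Y) = Ad A (L X Y);
  lc_torsion_free : forall X Y, in_p X -> in_p Y ->
    L X Y - L Y X - pr_p (bracket X Y) = 0;
  lc_metric : forall X Y Z, in_p X -> in_p Y -> in_p Z ->
    Q (L X Y) Z + Q Y (L X Z) = 0
}.

Definition curvature (R : realType) (n : nat)
    (L : 'M[R]_n -> 'M[R]_n -> 'M[R]_n) (X Y Z : 'M[R]_n) : 'M[R]_n :=
  L X (L Y Z) - L Y (L X Z) - L (pr_p (bracket X Y)) Z
  - bracket (pr_h (bracket X Y)) Z.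

Definition ricci (R : realType) (n : nat)
    (L : 'M[R]_n -> 'M[R]_n -> 'M[R]_n) (Y Z : 'M[R]_n) : R :=
  trace_p (fun X => curvature L X Y Z).

(* Both sides are invariant, so equality at eH is equality everywhere.       *)
Definition einstein (R : realType) (n : nat) (Q : 'M[R]_n -> 'M[R]_n -> R) :
    Prop :=
  exists L, levi_civita Q L /\
    exists lambda : R, forall Y Z, in_p Y -> in_p Z ->
      ricci L Y Z = lambda * Q Y Z.

Definition blk (k1 k2 n : nat) (i : 'I_n) : nat :=
  if (i < k1)%N then 1%N else if (i < k1 + k2)%N then 2%N else 3%N.

(* The component of X in so(k_b) if b = c, and in m_bc if b < c. *)
Definition block_part (R : realType) (k1 k2 n b c : nat) (X : 'M[R]_n) :
    'M[R]_n :=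
  \matrix_(i, j)
    (if ((blk k1 k2 i == b) && (blk k1 k2 j == c))
        || ((blk k1 k2 i == c) && (blk k1 k2 j == b))
     then X i j else 0).

(* (-B) restricted to so(k_b) or m_bc, extended by 0 on the other blocks.    *)
Definition negB (R : realType) (n k1 k2 b c : nat) (X Y : 'M[R]_n) : R :=
  - killing (block_part k1 k2 b c X) (block_part k1 k2 b c Y).

(* SO(k1) x SO(k2) x SO(k3); a block of size 1 contributes the trivial group. *)
Definition in_block_SO (R : realType) (n k1 k2 : nat) (A : 'M[R]_n) : Prop :=
  exists A1 A2 A3 : 'M[R]_n,
    [/\ SO_on (fun i => blk k1 k2 i == 1%N) A1,
        SO_on (fun i => blk k1 k2 i == 2%N) A2,
        SO_on (fun i => blk k1 k2 i == 3%N) A3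
      & A = A1 *m A2 *m A3].

Definition metric_1_4 (R : realType) (n : nat) (x2 x12 x13 x23 : R)
    (X Y : 'M[R]_n) : R :=
  x2 * negB 1 4 2 2 X Y + x12 * negB 1 4 1 2 X Y
  + x13 * negB 1 4 1 3 X Y + x23 * negB 1 4 2 3 X Y.

Definition metric_2_3 (R : realType) (n : nat) (x1 x2 x12 x13 x23 : R)
    (X Y : 'M[R]_n) : R :=
  x1 * negB 2 3 1 1 X Y + x2 * negB 2 3 2 2 X Y + x12 * negB 2 3 1 2 X Y
  + x13 * negB 2 3 1 3 X Y + x23 * negB 2 3 2 3 X Y.

(* For sizes (5, 0, n-5), so(k_1) is so(5) and m_13 is the complement q. *)
Definition jensen_metric (R : realType) (n : nat) (a : R) (X Y : 'M[R]_n) : R :=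
  a * negB 5 0 1 1 X Y + negB 5 0 1 3 X Y.

Definition jensen_plus (R : realType) (n : nat) : R :=
  (n%:R - 2 + Num.sqrt (n%:R ^+ 2 - 7 * n%:R + 7)) / (n%:R - 1).

Definition jensen_minus (R : realType) (n : nat) : R :=
  (n%:R - 2 - Num.sqrt (n%:R ^+ 2 - 7 * n%:R + 7)) / (n%:R - 1).

Lemma in_soE (R : realType) (n : nat) (X : 'M[R]_n) i j :
  in_so X -> X j i = - X i j.
Proof. by move=> /matrixP /(_ i j); rewrite !mxE. Qed.

Lemma in_so_diag (R : realType) (n : nat) (X : 'M[R]_n) i :
  in_so X -> X i i = 0.
Proof.
move=> /(in_soE i i) /eqP; rewrite -subr_eq0 opprK -mulr2n mulrn_eq0 /=.
by move/eqP.
Qed.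

Lemma skew_expansion (R : realType) (n : nat) (P : rel 'I_n) (X : 'M[R]_n) :
  symmetric P -> in_so X -> (forall i j, ~~ P i j -> X i j = 0) ->
  X = \sum_(i < n) \sum_(j < n | (i < j)%N && P i j) X i j *: skew_delta R i j.
Proof.
move=> symP sX PX.
pose c (i j : 'I_n) : R := ((i < j)%N && P i j)%:R * X i j.
have cE : \sum_(i < n) \sum_(j < n | (i < j)%N && P i j)
      X i j *: skew_delta R i j
    = \sum_(i < n) \sum_(j < n) c i j *: delta_mx i j
      - \sum_(i < n) \sum_(j < n) c j i *: delta_mx i j.
  rewrite [X in _ - X]exchange_big /= -sumrB; apply: eq_bigr => i _.
  rewrite big_mkcond -sumrB; apply: eq_bigr => j _.
  by rewrite /c /skew_delta; case: ifP => _;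
    rewrite ?mul1r ?mul0r ?scale0r ?subrr ?scalerBr.
have dE (f : 'I_n -> 'I_n -> R) a b :
    (\sum_(i < n) \sum_(j < n) f i j *: delta_mx i j) a b = f a b.
  rewrite summxE (bigD1 a) //= summxE (bigD1 b) //= !mxE !eqxx mulr1.
  rewrite big1 => [|j jb]; last by rewrite !mxE eq_sym (negPf jb) andbF mulr0.
  rewrite addr0 big1 ?addr0 // => i ia; rewrite summxE big1 // => j _.
  by rewrite !mxE eq_sym (negPf ia) mulr0.
apply/matrixP => a b; rewrite cE mxE [X in _ + X]mxE !dE /c (symP b a).
case Pab: (P a b); last by rewrite !andbF !mul0r subr0 PX ?Pab.
rewrite !andbT; case: ltngtP => [||/val_inj e];
  rewrite ?mul1r ?mul0r ?subr0 ?sub0r //; first by rewrite (in_soE b a).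
by rewrite e in_so_diag.
Qed.

Lemma killingE (R : realType) (n : nat) (X Y : 'M[R]_n) :
  in_so X -> in_so Y -> killing X Y = (n%:R - 2) * \tr (X *m Y).
Proof.
move=> sX sY.
pose t (i : 'I_n) : R := (X *m Y) i i.
have tC i : (Y *m X) i i = t i.
  rewrite /t !mxE; apply: eq_bigr => k _.
  by rewrite (in_soE k i sX) (in_soE i k sY); ring.
pose g (i j : 'I_n) : R := t i + t j + 2 * (X i j * Y i j).
have dl (A : 'M[R]_n) (i j a b : 'I_n) :
    (A *m delta_mx i j) a b = A a i * (b == j)%:R.
  rewrite mxE (bigD1 i) //= big1 ?addr0 => [|k ki]; first by rewrite mxE eqxx.
  by rewrite mxE (negPf ki) mulr0.
have dr (A : 'M[R]_n) (i j a b : 'I_n) :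
    (delta_mx i j *m A) a b = (a == i)%:R * A j b.
  rewrite mxE (bigD1 j) //= big1 ?addr0 => [|k ki]; first by rewrite mxE eqxx andbT.
  by rewrite mxE (negPf ki) andbF mul0r.
have dm (A B : 'M[R]_n) (i j a b : 'I_n) :
    (A *m (delta_mx i j *m B)) a b = A a i * B j b.
  rewrite mxE (bigD1 i) //= big1 ?addr0 => [|k ki]; first by rewrite dr eqxx mul1r.
  by rewrite dr (negPf ki) mul0r mulr0.
have fE (i j : 'I_n) : i != j ->
    bracket X (bracket Y (skew_delta R i j)) i j = g i j.
  move=> ij; rewrite /bracket /skew_delta !(mulmxBr, mulmxBl) -!mulmxA.
  rewrite !(mulmxA X Y).
  have sub (A B : 'M[R]_n) : (A - B) i j = A i j - B i j by rewrite !mxE.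
  rewrite !sub !dl !dr !dm !eqxx eq_sym (negPf ij) tC.
  by rewrite !(in_so_diag _ sX) !(in_so_diag _ sY) mulr1n mulr0n /g /t; ring.
have gC i j : g i j = g j i.
  by rewrite /g (in_soE i j sX) (in_soE i j sY); ring.
have -> : killing X Y = \sum_(i < n) \sum_(j < n | (i < j)%N) g i j.
  rewrite /killing /trace_on; apply: eq_bigr => i _.
  under eq_bigl do rewrite andbT.
  by apply: eq_bigr => j ij; rewrite fE // -val_eqE neq_ltn ij.
have /(mulfI (_ : 2 != 0 :> R)) : 
    2 * (\sum_(i < n) \sum_(j < n | (i < j)%N) g i j)
    = 2 * ((n%:R - 2) * \tr (X *m Y)); last by apply; rewrite pnatr_eq0.
have tE : \tr (X *m Y) = \sum_(i < n) t i by [].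
have xyE : \sum_(i < n) \sum_(j < n) X i j * Y i j = - \tr (X *m Y).
  rewrite tE -sumrN; apply: eq_bigr => i _; rewrite /t mxE -sumrN.
  by apply: eq_bigr => j _; rewrite (in_soE i j sY); ring.
have -> : 2 * (\sum_(i < n) \sum_(j < n | (i < j)%N) g i j)
    = \sum_(i < n) \sum_(j < n) g i j - \sum_(i < n) g i i.
  rewrite mulr2n mulrDl mul1r [X in _ + X](exchange_big_dep xpredT) //= -big_split -sumrB /=.
  apply: eq_bigr => i _; rewrite [in RHS](bigID (fun j : 'I_n => (i < j)%N)) /=.
  rewrite -addrA; congr (_ + _).
  rewrite [in RHS](bigD1 i) ?ltnn //= addrC addrA addNr add0r.
  apply: eq_big => [j|j _]; last exact: gC.
  by rewrite -leqNgt ltn_neqAle andbC.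
have -> : \sum_(i < n) \sum_(j < n) g i j
    = n%:R * \tr (X *m Y) + n%:R * \tr (X *m Y) - 2 * \tr (X *m Y).
  rewrite -mulrN -xyE.
  transitivity (\sum_(i < n) (n%:R * t i + \tr (X *m Y)
                 + 2 * \sum_(j < n) X i j * Y i j)).
    apply: eq_bigr => i _; rewrite /g big_split big_split /= -mulr_sumr tE.
    by rewrite [X in X + _ + _]sumr_const card_ord (mulr_natl (t i) n).
  by rewrite !big_split /= -!mulr_sumr sumr_const card_ord -tE (mulr_natl (\tr _) n).
have -> : \sum_(i < n) g i i = 2 * \tr (X *m Y).
  rewrite tE mulr_sumr; apply: eq_bigr => i _.
  by rewrite /g (in_so_diag i sX); ring.
ring.
Qed.

Lemma in_pP (R : realType) (n : nat) (X : 'M[R]_n) : (2 < n)%N ->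
  in_p X <-> in_so X /\ forall i j, lower i && lower j -> X i j = 0.
Proof.
move=> n2; have n2R : n%:R - 2 != 0 :> R by rewrite subr_eq0 eqr_nat gtn_eqF.
split=> [[sX hX]|[sX hX]]; split=> //.
  pose Y := pr_h X.
  have YE i j : Y i j = if lower i && lower j then X i j else 0.
    by rewrite !mxE; case: ifP => _; rewrite ?subr0 ?subrr.
  have sY : in_so Y.
    by apply/matrixP => i j; rewrite mxE [RHS]mxE !YE andbC (in_soE i j sX);
      case: ifP => _; rewrite ?oppr0.
  have /eqP : killing X Y = 0.
    by apply: hX; split=> // i j /negPf ij; rewrite YE ij.
  rewrite killingE // mulf_eq0 (negPf n2R) /= => /eqP trXY.
  have : \sum_(i < n) \sum_(j < n) Y i j ^+ 2 = 0.
    apply: oppr_inj; rewrite oppr0 -[RHS]trXY -sumrN; apply: eq_bigr => i _.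
    rewrite [in RHS]mxE -sumrN; apply: eq_bigr => j _.
    by rewrite (in_soE i j sY) YE; case: ifP => _; ring.
  move=> /eqP; rewrite psumr_eq0 => [/allP s0 i j ij|i _]; last first.
    by apply: sumr_ge0 => j _; exact: sqr_ge0.
  have := s0 i (mem_index_enum i); rewrite psumr_eq0 => [/allP|k _]; last first.
    exact: sqr_ge0.
  by move=> /(_ j (mem_index_enum j)); rewrite sqrf_eq0 YE ij => /eqP.
move=> Y [sY hY]; rewrite killingE // /mxtrace big1 ?mulr0 // => i _.
rewrite mxE big1 // => j _; case ij: (lower i && lower j).
  by rewrite hX // mul0r.
by rewrite hY ?mulr0 // andbC ij.
Qed.

Lemma pr_p_in_p (R : realType) (n : nat) (X : 'M[R]_n) : (2 < n)%N ->
  in_so X -> in_p (pr_p X).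
Proof.
move=> n2 sX; apply/in_pP => //; split=> [|i j ij]; last by rewrite mxE ij.
apply/matrixP => i j; rewrite !mxE andbC (in_soE i j sX).
by case: ifP => _; rewrite ?oppr0.
Qed.

Lemma pr_h_in_h (R : realType) (n : nat) (X : 'M[R]_n) :
  in_so X -> in_h (pr_h X).
Proof.
move=> sX; split=> [|i j /negPf ij]; last by rewrite !mxE ij subrr.
apply/matrixP => i j; rewrite !mxE andbC (in_soE i j sX).
by case: ifP => _; ring.
Qed.

(* Main.v *)
From Stdlib Require Import ZArith.
Require Import Defs.
From mathcomp Require Import all_boot all_order all_algebra.
From mathcomp Require Import boolp classical_sets functions.
From mathcomp Require Import reals topology normedtype derive.
From mathcomp Require Import ring lra ssrZ.

Set Implicit Arguments.
Unset Strict Implicit.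
Unset Printing Implicit Defensive.

Import Order.TTheory GRing.Theory Num.Theory.
Import numFieldNormedType.Exports.

Local Open Scope ring_scope.

(** All metrics of the theorem are diagonal in the basis of elementary skew
    matrices: the inner product is a multiple of the sum of
    w i j * (X i j * Y i j), where the weight w i j only depends on the blocks
    of i and j. For such a metric the Levi-Civita connection is a bracket of
    matrices in which the product X i k * Y k j has an explicit coefficient
    ([weighted_levi_civita]), and computing traces shows that the Ricci form is
    diagonal too ([ricci_tbracket]): its coefficient on the edge (i, k) is a
    sum over the third index j of a rational function of the weights of the
    triangle i, j, k. The metric is therefore Einstein as soon as these
    coefficients are proportional to the weights, which is one equation for
    each block ([block_einstein]). For Jensen's metrics they reduce to a
    quadratic equation.

    For the blocks (1,4,n-5) and (2,3,n-5), all unknowns except x12, x13, x23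
    can be eliminated rationally, and two homogeneous polynomial equations in
    these three remain, with the parameter m = n - 5 ([system_1_4],
    [system_2_3]). In each case there are two solutions other than Jensen's,
    one with x13 < x23 and one with x13 > x23. To locate a solution, a
    rectangle in (x13 : x12 : x23) that depends on m is given such that the
    first equation is monotone in x12 and changes sign between the sides where
    x12 is constant, while on its zero set the second equation changes sign
    between the other two sides; the two equations then have a common zero
    ([zero_in_rectangle]). Each of these sign conditions says that a polynomial
    in m and in the coordinates of the rectangle is positive, and it becomes
    visible when the polynomial is written in barycentric coordinates and in
    m - 2 >= 0: all coefficients are then nonnegative. The coefficients are
    computed by normalizing expressions, once for all m
    ([certificate_1_4_lt] and the lemmas after it).

    Homothetic diagonal metrics have proportional weights, so the six metrics
    are told apart by ratios of weights. *)

(** * Polynomial expressions and their normal forms *)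

Inductive expr :=
  | Cst of nat | Var of nat | Add of expr & expr | Opp of expr
  | Mul of expr & expr.

Declare Scope expr_scope.
Delimit Scope expr_scope with expr.
Bind Scope expr_scope with expr.
Notation "x + y" := (Add x y) : expr_scope.
Notation "- x" := (Opp x) : expr_scope.
Notation "x - y" := (Add x (Opp y)) : expr_scope.
Notation "x * y" := (Mul x y) : expr_scope.

Definition expn_expr (x : expr) (n : nat) : expr := iterop n Mul x (Cst 1).
Notation "x ^+ n" := (expn_expr x n) : expr_scope.

Definition expr_of_num (d : Number.uint) : expr := Cst (Nat.of_num_uint d).
Definition num_of_expr (x : expr) : option Number.uint :=
  if x is Cst k then Some (Nat.to_num_uint k) else None.
Number Notation expr expr_of_num num_of_expr : expr_scope.

Definition of_Z (R : realType) (z : Z) : R := (int_of_Z z)%:~R.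
Arguments of_Z : simpl never.

Fixpoint interp (R : realType) (env : seq R) (x : expr) : R :=
  match x with
  | Cst k => k%:R
  | Var i => env`_i
  | Add a b => interp env a + interp env b
  | Opp a => - interp env a
  | Mul a b => interp env a * interp env b
  end.

Fixpoint derive_expr (i : nat) (x : expr) : expr :=
  match x with
  | Cst _ => 0
  | Var j => if i == j then 1 else 0
  | Add a b => derive_expr i a + derive_expr i b
  | Opp a => - derive_expr i a
  | Mul a b => derive_expr i a * b + a * derive_expr i b
  end%expr.

(** Dense Horner form, recursive in the number of variables: a polynomial in
    n.+1 variables is the list of its coefficients in variable 0, and these
    are polynomials in the remaining variables. Only integers are computed
    with, so that normal forms can be evaluated by the kernel. *)
Fixpoint pol (n : nat) : Type := if n is n'.+1 then seq (pol n') else Z.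

Fixpoint peval (R : realType) (n : nat) (env : seq R) : pol n -> R :=
  match n with
  | 0 => of_Z R
  | n'.+1 => fun p =>
      foldr (fun a r => peval (behead env) a + head 0 env * r) 0 p
  end.

Fixpoint pconst (n : nat) (z : Z) : pol n :=
  match n with 0 => z | n'.+1 => [:: pconst n' z] end.

Fixpoint pvar (n i : nat) : pol n :=
  match n with
  | 0 => Z0
  | n'.+1 =>
      if i is i'.+1 then [:: pvar n' i']
      else [:: pconst n' Z0; pconst n' (Zpos xH)]
  end.

Fixpoint pmap2 (A : Type) (f : A -> A -> A) (s t : seq A) : seq A :=
  match s, t with
  | [::], _ => t
  | _, [::] => s
  | a :: s', b :: t' => f a b :: pmap2 f s' t'
  end.

Fixpoint padd (n : nat) : pol n -> pol n -> pol n :=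
  match n with
  | 0 => Z.add
  | n'.+1 => pmap2 (@padd n')
  end.

Fixpoint popp (n : nat) : pol n -> pol n :=
  match n with
  | 0 => Z.opp
  | n'.+1 => map (@popp n')
  end.

Fixpoint pmul (n : nat) : pol n -> pol n -> pol n :=
  match n with
  | 0 => Z.mul
  | n'.+1 => fun p q =>
      foldr (fun a r => pmap2 (@padd n') (map (pmul a) q) (pconst n' Z0 :: r))
        [::] p
  end.

Fixpoint pnonneg (n : nat) : pol n -> bool :=
  match n with
  | 0 => Z.leb Z0
  | n'.+1 => all (@pnonneg n')
  end.

Fixpoint normalize (n : nat) (env : seq (pol n)) (x : expr) : pol n :=
  match x with
  | Cst k => pconst n (Z.of_nat k)
  | Var i => nth (pconst n Z0) env i
  | Add a b => padd (normalize env a) (normalize env b)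
  | Opp a => popp (normalize env a)
  | Mul a b => pmul (normalize env a) (normalize env b)
  end.

Section Eval.
Variable R : realType.
Implicit Types env : seq R.

Lemma of_ZD a b : of_Z R (Z.add a b) = of_Z R a + of_Z R b.
Proof. by rewrite /of_Z (raddfD int_of_Z) intrD. Qed.

Lemma of_ZM a b : of_Z R (Z.mul a b) = of_Z R a * of_Z R b.
Proof. by rewrite /of_Z (rmorphM int_of_Z) intrM. Qed.

Lemma of_ZN a : of_Z R (Z.opp a) = - of_Z R a.
Proof. by rewrite /of_Z (raddfN int_of_Z) mulrNz. Qed.

Lemma of_Z_ge0 a : Z.leb Z0 a -> 0 <= of_Z R a.
Proof. by rewrite /of_Z ler0z; case: a. Qed.

Lemma peval_const n env z : peval env (pconst n z) = of_Z R z.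
Proof. by elim: n env => //= n IHn env; rewrite IHn mulr0 addr0. Qed.

Lemma peval_var n env i : (i < n)%N -> peval env (pvar n i) = env`_i.
Proof.
elim: n env i => [env i|n IHn env [_|i ni]] /=; first by rewrite ltn0.
  by rewrite !peval_const /of_Z /= mulr0 addr0 add0r mulr1 nth0.
by rewrite IHn // mulr0 addr0 nth_behead.
Qed.

Lemma peval_add n env (p q : pol n) :
  peval env (padd p q) = peval env p + peval env q.
Proof.
elim: n env p q => [|n IHn] env p q /=; first exact: of_ZD.
elim: p q => [|a p IHp] [|b q] /=; rewrite ?add0r ?addr0 //.
by rewrite IHn IHp; ring.
Qed.

Lemma peval_opp n env (p : pol n) : peval env (popp p) = - peval env p.
Proof.
elim: n env p => [|n IHn] env p /=; first exact: of_ZN.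
by elim: p => [|a p IHp] /=; rewrite ?oppr0 // IHn IHp; ring.
Qed.

Lemma peval_mul n env (p q : pol n) :
  peval env (pmul p q) = peval env p * peval env q.
Proof.
elim: n env p q => [|n IHn] env p q /=; first exact: of_ZM.
elim: p => [|a p IHp] /=; first by rewrite mul0r.
have := peval_add env (map (pmul a) q : pol n.+1) (pconst n Z0 :: foldr
   (fun a r => pmap2 (@padd n) (map (pmul a) q) (pconst n Z0 :: r)) [::] p).
move=> /= ->; rewrite IHp peval_const.
have -> : foldr (fun a r => peval (behead env) a + head 0 env * r) 0
    (map (pmul a) q) = peval (behead env) a *
    foldr (fun a r => peval (behead env) a + head 0 env * r) 0 q.
  by elim: q {IHp} => [|b q IHq] /=; rewrite ?mulr0 // IHn IHq; ring.
by rewrite /of_Z /=; ring.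
Qed.

Lemma peval_ge0 n env (p : pol n) :
  (forall i, 0 <= env`_i) -> pnonneg p -> 0 <= peval env p.
Proof.
elim: n env p => [|n IHn] env p env_ge0 /=; first exact: of_Z_ge0.
elim: p => //= a p IHp /andP[a_ge0 /IHp ge0].
rewrite addr_ge0 ?mulr_ge0 // -?nth0 //.
by apply: IHn => // i; rewrite nth_behead.
Qed.

(** Evaluating a normal form computed in an environment of polynomials is
    evaluating the expression at the values of these polynomials: this is what
    substitutes the parametrization of a box into an expression. *)
Lemma interp_normalize n env (s : seq (pol n)) x :
  peval env (normalize s x) = interp (map (peval env) s) x.
Proof.
elim: x => [k|i|a IHa b IHb|a IHa|a IHa b IHb] /=.
- by rewrite peval_const /of_Z (Z_of_intK (Posz k)).
- elim: s i => [|p s IHs] [|i] //=; by rewrite peval_const.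
- by rewrite peval_add IHa IHb.
- by rewrite peval_opp IHa.
- by rewrite peval_mul IHa IHb.
Qed.

Lemma interp_opp_eq0 env x : interp env (- x)%expr = 0 -> interp env x = 0.
Proof. by move=> /= /eqP; rewrite oppr_eq0 => /eqP. Qed.

End Eval.

(** * Common zeros in a rectangle *)

Section Rectangle.
Local Open Scope classical_set_scope.

Lemma continuous_pair (T U V : topologicalType) (f : T -> U) (g : T -> V) x :
  {for x, continuous f} -> {for x, continuous g} ->
  {for x, continuous (fun t => (f t, g t))}.
Proof. by move=> cf cg; exact: (cvg_pair cf cg). Qed.

(** Monotonicity in the second variable makes the zero set of f the graph of a
    function phi of the first one; phi is continuous because f keeps its sign
    at a fixed height above or below the graph when the first variable moves a
    little. The intermediate value theorem then applies to g on the graph. *)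
Lemma zero_in_rectangle (R : realType) (f g : R * R -> R) (a b c d : R) :
  a <= b -> c <= d -> continuous f -> continuous g ->
  (forall x, a <= x <= b -> f (x, c) < 0 < f (x, d)) ->
  (forall x y z, a <= x <= b -> c <= y -> y < z -> z <= d ->
     f (x, y) < f (x, z)) ->
  (forall y, c <= y <= d -> f (a, y) = 0 -> g (a, y) <= 0) ->
  (forall y, c <= y <= d -> f (b, y) = 0 -> 0 <= g (b, y)) ->
  exists x y, [/\ a <= x <= b, c <= y <= d, f (x, y) = 0 & g (x, y) = 0].
Proof.
move=> ab cd cf cg fcd finc ga gb.
(* Clamping to [a, b] turns every function below into one that is continuous
   on the whole line. *)
pose clamp (x : R) := Num.min (Num.max x a) b.
have clampP x : a <= clamp x <= b.
  by rewrite /clamp le_min ge_min le_max lexx ab orbT /= lexx orbT.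
have clampK x : a <= x <= b -> clamp x = x.
  by rewrite /clamp => /andP[ax xb]; rewrite max_l // min_l.
have cclamp : continuous clamp.
  move=> x.
  apply: (@continuous_min _ _ (fun x => Num.max x a) (cst b)).
    by apply: (@continuous_max _ _ id (cst a)); [exact: cvg_id|exact: cvg_cst].
  exact: cvg_cst.
have root x : exists y, (c <= y <= d) && (f (clamp x, y) == 0).
  have /andP[fc fd] := fcd _ (clampP x).
  have cfx : {within `[c, d], continuous (fun y => f (clamp x, y))}.
    apply: continuous_subspaceT => y.
    apply: (@continuous_comp _ _ _ (fun y => (clamp x, y)) f); last exact: cf.
    by apply: continuous_pair; [exact: cvg_cst|exact: cvg_id].
  have [|y] := @IVT R _ c d 0 cd cfx.
    by rewrite ge_min le_max (ltW fc) (ltW fd) orbT.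
  by rewrite in_itv /= => yI /eqP fy; exists y; rewrite yI.
pose phi x := xchoose (root x).
have phiP x : c <= phi x <= d /\ f (clamp x, phi x) = 0.
  by have /andP[? /eqP ?] := xchooseP (root x).
have cphi : continuous phi.
  move=> x; apply/cvgrPdist_lt => e e0.
  have cfy y : (fun x' => f (clamp x', y)) x' @[x' --> x] --> f (clamp x, y).
    apply: (@continuous_comp _ _ _ (fun x' => (clamp x', y)) f); last exact: cf.
    by apply: continuous_pair; [exact: cclamp|exact: cvg_cst].
  have [yI fy] := phiP x.
  have hi : \forall x' \near x, phi x' < phi x + e.
    have [ed|de] := leP (phi x + e) d; last first.
      by near=> x'; have [/andP[_ ?] _] := phiP x'; lra.
    have : 0 < f (clamp x, phi x + e).
      by rewrite -fy; apply: finc => //; [case/andP: yI|lra].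
    move=> fe; apply: filterS (cvgr_gt _ (cfy _) _ fe) => x' fx'.
    rewrite ltNge; apply/negP => ex'.
    have [/andP[cx' x'd] fx'0] := phiP x'.
    move: ex'; rewrite le_eqVlt => /predU1P[ex'|ex'].
      by move: fx'; rewrite ex' fx'0 ltxx.
    have := finc (clamp x') (phi x + e) (phi x') (clampP x') _ ex' x'd.
    by move: yI => /andP[? ?]; rewrite fx'0 => /(_ _); lra.
  have lo : \forall x' \near x, phi x - e < phi x'.
    have [ce|ec] := leP c (phi x - e); last first.
      by near=> x'; have [/andP[? _] _] := phiP x'; lra.
    have : f (clamp x, phi x - e) < 0.
      by rewrite -fy; apply: finc => //; [lra|case/andP: yI].
    move=> fe; apply: filterS (cvgr_lt _ (cfy _) _ fe) => x' fx'.
    rewrite ltNge; apply/negP => ex'.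
    have [/andP[cx' x'd] fx'0] := phiP x'.
    move: ex'; rewrite le_eqVlt => /predU1P[ex'|ex'].
      by move: fx'; rewrite -ex' fx'0 ltxx.
    have := finc (clamp x') (phi x') (phi x - e) (clampP x') cx' ex'.
    by move: yI => /andP[? ?]; rewrite fx'0 => /(_ _); lra.
  near=> x'; rewrite ltr_distl; apply/andP; split.
    by rewrite ltrBlDr; near: x'.
  by near: x'; apply: filterS lo => x' ?; lra.
pose h x := g (clamp x, phi x).
have ch : {within `[a, b], continuous h}.
  apply: continuous_subspaceT => x; rewrite /h.
  apply: (@continuous_comp _ _ _ (fun x => (clamp x, phi x)) g); last exact: cg.
  by apply: continuous_pair; [exact: cclamp|exact: cphi].
have [|x] := @IVT R h a b 0 ab ch.
  rewrite ge_min le_max; apply/andP; split; apply/orP; [left|right].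
    have [yI] := phiP a; rewrite /h clampK ?lexx // => fa; exact: ga.
  have [yI] := phiP b; rewrite /h clampK ?lexx ?ab // => fb; exact: gb.
rewrite in_itv /= => xI hx; exists x, (phi x).
have [? fx] := phiP x; rewrite clampK // in fx.
by move: hx; rewrite /h clampK.
Unshelve. all: by end_near.
Qed.

End Rectangle.

(** * Zeros certified by positive coefficients *)

(** A box of homogeneous coordinates (u : v : w): u ranges between u_lo and
    u_hi, v between v_lo and v_hi, and w is fixed. The fields are polynomials
    in a parameter m, which is Var 0. *)
Record box := Box
  { u_lo : expr; u_hi : expr; v_lo : expr; v_hi : expr; w_box : expr }.

Definition box_bounds (b : box) : seq expr :=
  [:: u_lo b; u_hi b; v_lo b; v_hi b; w_box b; Var 0].

(** The point of the box with barycentric coordinates (s0, s1) in u and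
    (t0, t1) in v, as coordinates u, v, w, m, 1. Since s0 + s1 = t0 + t1 = 1,
    the factors s0 + s1 and t0 + t1 do not change the values, but they make
    u, v and w bihomogeneous of degree (1, 1). The coefficients of a
    homogeneous polynomial at this point are then, up to positive factors, its
    Bernstein coefficients on the box, and they tend to be positive when the
    polynomial is. *)
Definition box_point : seq expr :=
  let s0 := Var 6 in let s1 := Var 7 in let t0 := Var 8 in let t1 := Var 9 in
  [:: (s0 * Var 0 + s1 * Var 1) * (t0 + t1);
      (t0 * Var 2 + t1 * Var 3) * (s0 + s1);
      Var 4 * ((s0 + s1) * (t0 + t1));
      Var 5;
      (s0 + s1) * (t0 + t1)]%expr.

(** Sufficient for x >= 1 on the part of the box described by bary, for all
    m >= 2: the last variable is m - 2, and ((s0 + s1) * (t0 + t1)) ^+ d is 1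
    written in the degree of x. Subtracting it gives strict positivity from
    nonnegative coefficients. *)
Definition at_least_one (b : box) (bary : seq (pol 5)) (x : expr) (d : nat) :
    bool :=
  let m : pol 5 := normalize [:: pvar 5 4] (Var 0 + 2)%expr in
  let corners := map (normalize [:: m]) (box_bounds b) in
  let env := map (normalize (corners ++ bary)) box_point in
  pnonneg (normalize env (x - Var 4 ^+ d)%expr).

(** The hypotheses of [zero_in_rectangle] for f and g on the box, in a form that
    is decided by looking at coefficients. On the sides u = u_lo and u = u_hi
    only the zeros of f matter, so g may be corrected by a multiple of f. The
    list pos holds further expressions to be shown positive; df, dg and the
    numbers in pos are degrees in (u, v, w). *)
Definition certified (b : box) (f g c0 c1 : expr) (df dg : nat)
    (pos : seq (expr * nat)) : bool :=
  let one : pol 5 := normalize [::] (Cst 1) in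
  let zero : pol 5 := normalize [::] (Cst 0) in
  let s0 := pvar 5 0 in let s1 := pvar 5 1 in
  let t0 := pvar 5 2 in let t1 := pvar 5 3 in
  let m := normalize [:: pvar 5 4] (Var 0 + 2)%expr in
  let nonneg x := pnonneg (normalize [:: m] x) in
  [&& nonneg (u_hi b - u_lo b)%expr, nonneg (v_hi b - v_lo b)%expr,
      at_least_one b [:: s0; s1; one; zero] (- f)%expr df,
      at_least_one b [:: s0; s1; zero; one] f df,
      at_least_one b [:: s0; s1; t0; t1] (derive_expr 1 f) df.-1,
      at_least_one b [:: one; zero; t0; t1] (c0 * f - g)%expr dg,
      at_least_one b [:: zero; one; t0; t1] (g - c1 * f)%expr dg
    & all (fun x => at_least_one b [:: s0; s1; t0; t1] x.1 x.2) pos].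

Section Box.
Local Open Scope classical_set_scope.
Variable R : realType.
Implicit Types (x : expr) (e : seq R).

Lemma interp_exp e x n : interp e (x ^+ n)%expr = interp e x ^+ n.
Proof.
case: n => [|n]; rewrite /expn_expr ?iteropS //.
by elim: n => [|n IHn]; rewrite ?expr1 // exprS iterS /= IHn.
Qed.

Lemma interp_continuous (w m : R) x :
  continuous (fun p : R * R => interp [:: p.1; p.2; w; m; 1] x).
Proof.
elim: x => [k|i|a ca b cb|a ca|a ca b cb] p /=.
- exact: cvg_cst.
- case: i => [|[|[|[|[|i]]]]] /=; try exact: cvg_cst.
    exact: cvg_fst.
  exact: cvg_snd.
- exact: cvgD (ca p) (cb p).
- exact: cvgN (ca p).
- exact: cvgM (ca p) (cb p).
Qed.

(** Formal and analytic derivatives agree, so that monotonicity in v can be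
    read off from the coefficients of the formal derivative. *)
Lemma interp_derive (u w m y : R) x :
  is_derive y 1 (fun v => interp [:: u; v; w; m; 1] x)
    (interp [:: u; y; w; m; 1] (derive_expr 1 x)).
Proof.
elim: x => [k|i|a da b db|a da|a da b db] /=.
- exact: is_derive_cst.
- case: i => [|[|[|[|[|i]]]]] /=; try exact: is_derive_cst.
  exact: is_derive_id.
- exact: is_deriveD.
- exact: is_deriveN.
- by rewrite addrC [X in _ + X]mulrC; exact: is_deriveM.
Qed.


Lemma interp_strict_increasing (u w m c d : R) x :
  (forall v, c <= v <= d -> 0 < interp [:: u; v; w; m; 1] (derive_expr 1 x)) ->
  forall y z, c <= y -> y < z -> z <= d ->
  interp [:: u; y; w; m; 1] x < interp [:: u; z; w; m; 1] x.
Proof.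
move=> x'0 y z cy yz zd.
have [v _||v /itvP vI e] := @MVT R (fun v => interp [:: u; v; w; m; 1] x)
    (fun v => interp [:: u; v; w; m; 1] (derive_expr 1 x)) y z yz.
- exact: interp_derive.
- apply: continuous_subspaceT => v.
  apply/differentiable_continuous/derivable1_diffP.
  by case: (interp_derive u w m v x).
rewrite -subr_gt0 e mulr_gt0 ?subr_gt0 // x'0 //.
by rewrite (le_trans cy) ?vI // (le_trans _ zd) ?vI.
Qed.

Lemma peval_parameter (pt : seq R) :
  map (peval pt) [:: normalize [:: pvar 5 4] (Var 0 + 2)%expr] = [:: pt`_4 + 2].
Proof.
by congr [:: _]; rewrite interp_normalize; congr (_ + _); apply: peval_var.
Qed.

Lemma at_least_oneP b (bary : seq (pol 5)) x d (pt : seq R) s0 s1 t0 t1 :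
  (forall i, 0 <= pt`_i) -> map (peval pt) bary = [:: s0; s1; t0; t1] ->
  s0 + s1 = 1 -> t0 + t1 = 1 -> at_least_one b bary x d ->
  let at_m := interp [:: pt`_4 + 2] in
  1 <= interp [:: s0 * at_m (u_lo b) + s1 * at_m (u_hi b);
                  t0 * at_m (v_lo b) + t1 * at_m (v_hi b);
                  at_m (w_box b); pt`_4 + 2; 1] x.
Proof.
move=> pt0 baryE s1E t1E /(peval_ge0 pt0); rewrite interp_normalize.
set env := map (peval pt) _.
pose at_m := interp [:: pt`_4 + 2].
have -> : env = [:: s0 * at_m (u_lo b) + s1 * at_m (u_hi b);
    t0 * at_m (v_lo b) + t1 * at_m (v_hi b); at_m (w_box b); pt`_4 + 2; 1].
  rewrite /env -map_comp.
  rewrite (eq_map (interp_normalize pt _)) map_cat baryE.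
  rewrite -map_comp (eq_map (interp_normalize pt _)).
  by rewrite peval_parameter /= s1E t1E !mulr1.
rewrite /= interp_exp /= expr1n; lra.
Qed.

Lemma barycentric (a c x : R) : a <= c -> a <= x <= c ->
  exists s0 s1, [/\ 0 <= s0, 0 <= s1, s0 + s1 = 1 & x = s0 * a + s1 * c].
Proof.
move=> ac /andP[ax xc]; have [ca|ac'] := leP c a.
  by exists 1, 0; split; lra.
exists ((c - x) / (c - a)), ((x - a) / (c - a)).
by split; [apply: divr_ge0; lra|apply: divr_ge0; lra|field; lra|field; lra].
Qed.

(** The certificate is checked once and covers all real m >= 2. *)
Lemma certified_zero b (f g c0 c1 : expr) df dg pos (m : R) : 2 <= m ->
  certified b f g c0 c1 df dg pos ->
  exists u v w, let e := [:: u; v; w; m; 1] in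
    [/\ interp e f = 0, interp e g = 0
      & all (fun x : expr * nat => 0 < interp e x.1) pos].
Proof.
move=> m2; case/and5P => u_le v_le f_bot f_top.
case/and4P => f_inc g_left g_right pos1.
pose at_m := interp [:: m].
have at_mE s0 s1 t0 t1 : [:: s0; s1; t0; t1; m - 2]`_4 + 2 = m :> R.
  by rewrite /= subrK.
have pt0 s0 s1 t0 t1 : 0 <= s0 -> 0 <= s1 -> 0 <= t0 -> 0 <= t1 ->
    forall i, 0 <= [:: s0; s1; t0; t1; m - 2]`_i.
  by move=> ? ? ? ? [|[|[|[|[|i]]]]] //=; rewrite ?subr_ge0 // nth_nil.
have at_m_le x y :
    pnonneg (normalize [:: normalize [:: pvar 5 4] (Var 0 + 2)%expr]
      (y - x)%expr) -> at_m x <= at_m y.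
  move=> /(peval_ge0 (pt0 0 0 0 0 _ _ _ _)); rewrite !lexx.
  move=> /(_ isT isT isT isT).
  by rewrite interp_normalize peval_parameter at_mE /= subr_ge0.
pose point (x y : R) := [:: x; y; at_m (w_box b); m; 1].
have above (x : expr) d s0 s1 t0 t1 bary :
    0 <= s0 -> 0 <= s1 -> 0 <= t0 -> 0 <= t1 ->
    map (peval [:: s0; s1; t0; t1; m - 2]) bary = [:: s0; s1; t0; t1] ->
    s0 + s1 = 1 -> t0 + t1 = 1 -> at_least_one b bary x d ->
    0 < interp (point (s0 * at_m (u_lo b) + s1 * at_m (u_hi b))
                      (t0 * at_m (v_lo b) + t1 * at_m (v_hi b))) x.
  move=> s00 s10 t00 t10 baryE s1E t1E xd.
  have := at_least_oneP (pt0 _ _ _ _ s00 s10 t00 t10) baryE s1E t1E xd.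
  by rewrite at_mE; apply: lt_le_trans.
have := @zero_in_rectangle R (fun p => interp (point p.1 p.2) f)
  (fun p => interp (point p.1 p.2) g)
  (at_m (u_lo b)) (at_m (u_hi b)) (at_m (v_lo b)) (at_m (v_hi b))
  (at_m_le _ _ u_le) (at_m_le _ _ v_le) (@interp_continuous _ _ _)
  (@interp_continuous _ _ _).
have xP := barycentric (at_m_le _ _ u_le).
have yP := barycentric (at_m_le _ _ v_le).
case=> [x xI|x y z xI|y yI|y yI|x [y [xI yI f0 g0]]].
- have [s0 [s1 [s00 s10 s1E ->]]] := xP x xI; apply/andP; split.
    have := above _ _ s0 s1 1 0 _ s00 s10 ler01 (lexx 0) _ s1E (addr0 1) f_bot.
    rewrite /map !peval_var // !interp_normalize => /(_ erefl).
    by rewrite mul1r mul0r addr0 /= oppr_gt0.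
  have := above _ _ s0 s1 0 1 _ s00 s10 (lexx 0) ler01 _ s1E (add0r 1) f_top.
  rewrite /map !peval_var // !interp_normalize => /(_ erefl).
  by rewrite mul1r mul0r add0r.
- apply: interp_strict_increasing => v vI.
  have [s0 [s1 [s00 s10 s1E ->]]] := xP x xI.
  have [t0 [t1 [t00 t10 t1E ->]]] := yP v vI.
  by apply: above t1E f_inc; rewrite // /map !peval_var.
- have [t0 [t1 [t00 t10 t1E ->]]] := yP y yI.
  have := above _ _ 1 0 t0 t1 _ ler01 (lexx 0) t00 t10 _ (addr0 1) t1E g_left.
  rewrite /map !peval_var // !interp_normalize => /(_ erefl).
  rewrite mul1r mul0r addr0 /= => g0 f0; move: g0.
  by rewrite f0 mulr0 sub0r oppr_gt0 => /ltW.
- have [t0 [t1 [t00 t10 t1E ->]]] := yP y yI.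
  have := above _ _ 0 1 t0 t1 _ (lexx 0) ler01 t00 t10 _ (add0r 1) t1E g_right.
  rewrite /map !peval_var // !interp_normalize => /(_ erefl).
  rewrite mul1r mul0r add0r /= => g0 f0; move: g0.
  by rewrite f0 mulr0 subr0 => /ltW.
exists x, y, (at_m (w_box b)); split=> //.
apply: sub_all pos1 => -[p d] pd.
have [s0 [s1 [s00 s10 s1E ->]]] := xP x xI.
have [t0 [t1 [t00 t10 t1E ->]]] := yP y yI.
by apply: above s1E t1E pd; rewrite // /map !peval_var.
Qed.
End Box.

(** * Brackets twisted by structure coefficients *)

Section Twisted.
Variables (R : realType) (n : nat).
Implicit Types (X Y Z : 'M[R]_n) (i j k : 'I_n).

(** The bracket of matrices with the product of X i k and Y k j weighted by
    c i k j. The brackets of so(n), their projections to p and h, and the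
    Levi-Civita connections of diagonal metrics all have this shape, which
    lets one computation of traces serve for all terms of the curvature. *)
Definition tbracket (c : 'I_n -> 'I_n -> 'I_n -> R) X Y : 'M[R]_n :=
  \matrix_(i, j) \sum_k (c i k j * (X i k * Y k j) - c j k i * (Y i k * X k j)).

Implicit Types c d : 'I_n -> 'I_n -> 'I_n -> R.

Lemma tbracket_skew c X Y : in_so X -> in_so Y -> in_so (tbracket c X Y).
Proof.
move=> sX sY; apply/matrixP => i j; rewrite !mxE -sumrN; apply: eq_bigr => k _.
rewrite (in_soE k j sX) (in_soE i k sY) (in_soE k j sY) (in_soE i k sX).
ring.
Qed.

Lemma tbracket_linear_l c a X Y Z :
  tbracket c (a *: X + Y) Z = a *: tbracket c X Z + tbracket c Y Z.
Proof.
apply/matrixP => i j; rewrite !mxE mulr_sumr -big_split /=.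
by apply: eq_bigr => k _; rewrite !mxE; ring.
Qed.

Lemma tbracket_linear_r c a X Y Z :
  tbracket c X (a *: Y + Z) = a *: tbracket c X Y + tbracket c X Z.
Proof.
apply/matrixP => i j; rewrite !mxE mulr_sumr -big_split /=.
by apply: eq_bigr => k _; rewrite !mxE; ring.
Qed.

Lemma tbracketN c X Y : tbracket c (- X) Y = - tbracket c X Y.
Proof.
apply/matrixP => i j; rewrite !mxE -sumrN; apply: eq_bigr => k _.
by rewrite !mxE; ring.
Qed.

Lemma bracketE X Y : bracket X Y = tbracket (fun _ _ _ => 1) X Y.
Proof.
apply/matrixP => i j; rewrite !mxE -sumrB; apply: eq_bigr => k _.
by rewrite !mul1r.
Qed.

Definition in_pair i j : R := (~~ (lower i && lower j))%:R.

Lemma pr_p_bracketE X Y :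
  pr_p (bracket X Y) = tbracket (fun i _ j => in_pair i j) X Y.
Proof.
apply/matrixP => i j; rewrite bracketE !mxE /in_pair.
case: ifP => ij.
  by rewrite big1 // => k _; rewrite andbC ij /= !mul0r subrr.
by apply: eq_bigr => k _; rewrite [lower j && _]andbC ij.
Qed.

Lemma pr_h_bracketE X Y :
  pr_h (bracket X Y) = tbracket (fun i _ j => 1 - in_pair i j) X Y.
Proof.
rewrite /pr_h pr_p_bracketE bracketE; apply/matrixP => i j; rewrite !mxE -sumrB.
apply: eq_bigr => k _.
have -> : in_pair j i = in_pair i j by rewrite /in_pair andbC.
by rewrite !mul1r; ring.
Qed.

Lemma sum_delta (F : 'I_n -> R) j : \sum_k F k * (k == j)%:R = F j.
Proof.
rewrite (bigD1 j) //= eqxx mulr1 big1 ?addr0 // => k /negPf ->.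
by rewrite mulr0.
Qed.

Lemma skew_deltaC i j : skew_delta R i j = - skew_delta R j i.
Proof. by rewrite /skew_delta opprB. Qed.

Lemma skew_delta_skew i j : in_so (skew_delta R i j).
Proof. by rewrite /in_so /skew_delta raddfB /= !trmx_delta opprB. Qed.

Lemma tbracket_delta c i j Z k : in_so Z -> i != j ->
  tbracket c (skew_delta R i j) Z k j = - ((k != j)%:R * (c j i k * Z k i)).
Proof.
move=> sZ ij; rewrite mxE.
rewrite (eq_bigr (fun l => (c k l j * (k == i)%:R * Z l j) * (l == j)%:R
   - (c k l j * (k == j)%:R * Z l j + c j l k * Z k l) * (l == i)%:R)).
  rewrite sumrB !sum_delta (in_so_diag j sZ); have [->|kj] := eqVneq k j.
    by rewrite (in_soE i j sZ) ?eqxx /=; ring.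
  by rewrite /=; ring.
move=> l _; rewrite !mxE eqxx [j == i]eq_sym (negPf ij) andbF andbT.
by rewrite mulr0n -!mulnb !natrM; ring.
Qed.


Lemma tbracket_delta_l c i j Z k : in_so Z -> i != j ->
  tbracket c (skew_delta R i j) Z k i = (k != i)%:R * (c i j k * Z k j).
Proof.
move=> sZ ij; rewrite skew_deltaC tbracketN mxE tbracket_delta ?opprK //.
by rewrite eq_sym.
Qed.

(** These two lemmas are the traces that occur in the Ricci curvature. Only the
    paths i -> k -> j through a third index return to the (i, j) entry, and
    each product Y i k * Z i k occurs with an explicit coefficient: the Ricci
    form is diagonal in the basis of elementary skew matrices. *)
Lemma tbracket_outer c d i j Y Z : in_so Y -> in_so Z -> i != j ->
  let a i j := \sum_(k | k != j) c i k j * d j i k * (Y i k * Z i k) in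
  tbracket c Y (tbracket d (skew_delta R i j) Z) i j = a i j + a j i.
Proof.
move=> sY sZ ij; rewrite /= mxE.
have sW := tbracket_skew d (skew_delta_skew i j) sZ.
rewrite !(big_mkcond (fun k => k != _)) -big_split /=; apply: eq_bigr => k _.
rewrite (in_soE k i sW) tbracket_delta // tbracket_delta_l //.
rewrite (in_soE i k sZ) (in_soE j k sZ) (in_soE j k sY).
by case: ifP; case: ifP => _ _; rewrite /= ?mulr1n ?mulr0n; ring.
Qed.

Lemma tbracket_inner c d i j Y Z : in_so Y -> in_so Z -> i != j ->
  let b i j := \sum_(k | k != j) c j k i * d j i k * (Y i k * Z i k) in
  tbracket c (tbracket d (skew_delta R i j) Y) Z i j = - (b i j + b j i).
Proof.
move=> sY sZ ij; rewrite /= mxE.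
have sW := tbracket_skew d (skew_delta_skew i j) sY.
rewrite !(big_mkcond (fun k => k != _)) -big_split -sumrN /=.
apply: eq_bigr => k _.
rewrite (in_soE k i sW) tbracket_delta // tbracket_delta_l //.
rewrite (in_soE i k sY) (in_soE j k sY) (in_soE j k sZ).
by case: ifP; case: ifP => _ _; rewrite /= ?mulr1n ?mulr0n; ring.
Qed.

Lemma sum_pairs (P : rel 'I_n) (F : 'I_n -> 'I_n -> R) : symmetric P ->
  \sum_(i < n) \sum_(j < n | (i < j)%N && P i j) (F i j + F j i)
  = \sum_(i < n) \sum_(j < n | (j != i) && P i j) F i j.
Proof.
move=> symP.
have swap : \sum_(i < n) \sum_(j < n | (i < j)%N && P i j) F j i
    = \sum_(i < n) \sum_(j < n | (j < i)%N && P i j) F i j.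
  rewrite (exchange_big_dep xpredT) //=; apply: eq_bigr => i _.
  by apply: eq_bigl => j; rewrite symP.
under eq_bigr do rewrite big_split.
rewrite big_split /= swap -big_split; apply: eq_bigr => i _ /=.
rewrite [RHS](bigID (fun j : 'I_n => (i < j)%N)) /=; congr (_ + _).
  apply: eq_bigl => j; rewrite -val_eqE neq_ltn /=.
  by case: (ltngtP i j); rewrite ?andbF ?andbT.
apply: eq_bigl => j; rewrite -val_eqE neq_ltn /=.
by case: (ltngtP i j); rewrite ?andbF ?andbT.
Qed.

Section Ricci.
Variable c : 'I_n -> 'I_n -> 'I_n -> R.
Hypothesis c_in_p : forall i j k, lower i && lower j -> c i k j = 0.

(** The contribution of the index j to the coefficient of Y i k * Z i k in the
    Ricci form. The summands come from L Y (L X Z), from L [X, Y]_p Z and from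
    [[X, Y]_h, Z]; the term L X (L Y Z) has trace 0. *)
Definition ricci_term i k j : R :=
  - (c i k j * c j i k) + c j k i * in_pair j k
  + in_pair i j * (1 - in_pair j k).

Lemma ricci_tbracket Y Z : in_so Y -> in_so Z ->
  ricci (tbracket c) Y Z
  = \sum_i \sum_(k | k != i)
      (\sum_(j | (j != i) && (j != k)) ricci_term i k j) * (Y i k * Z i k).
Proof.
move=> sY sZ; rewrite /ricci /trace_p /trace_on.
pose F i j := \sum_(k | k != j) ricci_term i k j * (Y i k * Z i k).
transitivity (\sum_(i < n) \sum_(j < n | (i < j)%N && ~~ (lower i && lower j))
   (F i j + F j i)).
  apply: eq_bigr => i _; apply: eq_bigr => j /andP[ij Pij].
  have nij : i != j by rewrite -val_eqE neq_ltn ij.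
  rewrite /curvature pr_p_bracketE pr_h_bracketE bracketE.
  have sV := tbracket_skew c sY sZ.
  have sub (A B : 'M[R]_n) : (A - B) i j = A i j - B i j by rewrite !mxE.
  rewrite !sub tbracket_outer // !tbracket_inner //.
  have -> : tbracket c (skew_delta R i j) (tbracket c Y Z) i j = 0.
    by rewrite tbracket_delta // (in_so_diag i sV) !mulr0 oppr0.
  have split_term k l : in_pair k l = 1 ->
    F k l = - (\sum_(m | m != l) c k m l * c l k m * (Y k m * Z k m))
      + \sum_(m | m != l) c l m k * in_pair l m * (Y k m * Z k m)
      + \sum_(m | m != l) 1 * (1 - in_pair l m) * (Y k m * Z k m).
    move=> e1; rewrite -sumrN -!big_split; apply: eq_bigr => m _ /=.
    by rewrite /ricci_term e1; ring.
  rewrite (split_term i j) 1?(split_term j i); first by ring.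
    by rewrite /in_pair andbC Pij.
  by rewrite /in_pair Pij.
rewrite (sum_pairs F); last by move=> i j; rewrite andbC.
apply: eq_bigr => i _.
transitivity (\sum_(j | j != i) F i j).
  rewrite [RHS](bigID (fun j => ~~ (lower i && lower j))) /=.
  rewrite [X in _ + X]big1 ?addr0 // => j /andP[ji]; rewrite negbK => lij.
  rewrite /F big1 // => k _.
  rewrite /ricci_term (c_in_p k lij) (@c_in_p j i k) 1?andbC //.
  by rewrite /in_pair lij /= mulr0n; ring.
rewrite /F (exchange_big_dep xpredT) //=.
rewrite (bigD1 i) //= big1 ?add0r => [|j _]; last first.
  by rewrite (in_so_diag i sY) mul0r mulr0.
apply: eq_bigr => k ki; rewrite mulr_suml; apply: eq_bigl => j.
by rewrite [k == j]eq_sym.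
Qed.

End Ricci.

End Twisted.

(** * Diagonal metrics on so(n)/so(n-5) *)

Section Weighted.
Variables (R : realType) (n : nat) (w : 'I_n -> 'I_n -> R).
Hypothesis n_gt2 : (2 < n)%N.
Hypothesis wC : forall i j, w i j = w j i.
Hypothesis w_lower : forall i j, lower i && lower j -> w i j = 0.
Hypothesis w_gt0 : forall i j, ~~ (lower i && lower j) -> 0 < w i j.
Implicit Types (X Y Z A : 'M[R]_n) (i j k : 'I_n).

Definition wform X Y : R :=
  (n%:R - 2) * \sum_i \sum_j w i j * (X i j * Y i j).

(** The Koszul formula on a triangle of indices i, k, j. When i and j are both
    lower, w i j = 0 and the convention 0^-1 = 0 makes the coefficient 0, as it
    must be for a connection with values in p. *)
Definition lc_coef i k j : R :=
  (in_pair R i j + (w k j - w i k) / w i j) / 2.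

Definition hadamard (f : 'I_n -> 'I_n -> R) X : 'M[R]_n :=
  \matrix_(i, j) (f i j * X i j).

(** f does not separate the indices in S; then multiplication by f commutes
    with the adjoint action of the special orthogonal group on S. *)
Definition constant_on (S : pred 'I_n) (f : 'I_n -> 'I_n -> R) :=
  (forall i j, f i j = f j i) /\
  forall a i b, S a -> S i -> f a b = f i b.

Lemma orthogonal_invmx A : A *m A^T = 1%:M -> invmx A = A^T.
Proof.
move=> AAt; have [Au _] := mulmx1_unit AAt.
by rewrite -[RHS]mul1mx -(mulVmx Au) -mulmxA AAt mulmx1.
Qed.

Lemma SO_on_Ad S A X : SO_on S A -> Ad A X = A *m X *m A^T.
Proof. by case=> /orthogonal_invmx AV _ _; rewrite /Ad AV. Qed.

Lemma hadamard_Ad S f A X : SO_on S A -> constant_on S f ->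
  hadamard f (Ad A X) = Ad A (hadamard f X).
Proof.
move=> SA [fC fS]; rewrite !(SO_on_Ad _ SA).
have fA a i b : f a b * A a i = f i b * A a i.
  case: SA => _ _ Adiag; have [/andP[Sa Si]|nS] := boolP (S a && S i).
    by rewrite (fS a i b).
  by rewrite Adiag //; have [->|_] := eqVneq a i; rewrite ?mulr0.
apply/matrixP => a b; rewrite !mxE mulr_sumr; apply: eq_bigr => j _.
rewrite !mxE mulr_suml mulr_sumr mulr_suml; apply: eq_bigr => i _.
rewrite !mxE; transitivity (f a b * A a i * X i j * A b j); first by ring.
rewrite fA fC; transitivity (f b i * A b j * A a i * X i j); first by ring.
by rewrite fA fC; ring.
Qed.

Lemma bracket_Ad S A X Y : SO_on S A ->
  bracket (Ad A X) (Ad A Y) = Ad A (bracket X Y).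
Proof.
move=> SA; rewrite !(SO_on_Ad _ SA) /bracket.
have AtA : A^T *m A = 1%:M by case: SA => /mulmx1C.
have mul U V : A *m U *m A^T *m (A *m V *m A^T) = A *m (U *m V) *m A^T.
  by rewrite -!mulmxA (mulmxA A^T) AtA mul1mx.
by rewrite !mul mulmxBr mulmxBl.
Qed.

Lemma in_pairE i j : in_pair R i j = w i j * (w i j)^-1.
Proof.
rewrite /in_pair; case: (boolP (lower i && lower j)) => ij /=.
  by rewrite w_lower // mul0r.
by rewrite divff // gt_eqF // w_gt0.
Qed.

Lemma constant_on_in_pair S : constant_on S w -> constant_on S (@in_pair R n).
Proof.
move=> [_ wS]; split=> [i j|a i b Sa Si]; rewrite !in_pairE; first by rewrite wC.
by rewrite (wS a i b).
Qed.

(** The Levi-Civita connection without indices, D being multiplication by w: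
    L X Y = 1/2 ([X, Y]_p + D^-1 ([X, D Y] - [D X, Y])).
    Every operation on the right commutes with Ad A. *)
Lemma tbracket_lcE X Y : tbracket lc_coef X Y =
  2^-1 *: (hadamard (@in_pair R n) (bracket X Y)
    + hadamard (fun i j => (w i j)^-1)
        (bracket X (hadamard w Y) - bracket (hadamard w X) Y)).
Proof.
apply/matrixP => i j; rewrite !mxE -!sumrB !mulr_sumr -big_split mulr_sumr /=.
apply: eq_bigr => k _; rewrite !mxE /lc_coef.
have -> : in_pair R j i = in_pair R i j by rewrite /in_pair andbC.
by rewrite (wC k i) (wC j k) (wC j i); ring.
Qed.

Lemma in_pE X : in_p X <-> in_so X /\ hadamard (@in_pair R n) X = X.
Proof.
rewrite in_pP //; split=> -[sX XE]; split=> //.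
  apply/matrixP => i j; rewrite mxE /in_pair.
  by case: (boolP (_ && _)) => [/XE->|_]; rewrite ?mulr0 ?mul1r.
by move=> i j ij; rewrite -XE mxE /in_pair ij mul0r.
Qed.

Lemma Ad_in_so S A X : SO_on S A -> in_so X -> in_so (Ad A X).
Proof.
move=> SA sX; rewrite (SO_on_Ad _ SA) /in_so !trmx_mul trmxK sX.
by rewrite mulNmx mulmxN mulmxA.
Qed.

Lemma Ad_in_p S A X : SO_on S A -> constant_on S w -> in_p X -> in_p (Ad A X).
Proof.
move=> SA Sw /in_pE[sX XE]; apply/in_pE; split; first exact: Ad_in_so SA sX.
by rewrite (hadamard_Ad _ SA) ?XE //; apply: constant_on_in_pair.
Qed.

Lemma wformE X Y : in_so Y ->
  wform X Y = (2 - n%:R) * \tr (hadamard w X *m Y).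
Proof.
move=> sY; rewrite /wform -opprB mulNr -mulrN; congr (_ * _).
rewrite /mxtrace -sumrN; apply: eq_bigr => i _; rewrite mxE -sumrN.
by apply: eq_bigr => j _; rewrite !mxE (in_soE i j sY); ring.
Qed.

Lemma wform_Ad S A X Y : SO_on S A -> constant_on S w -> in_so Y ->
  wform (Ad A X) (Ad A Y) = wform X Y.
Proof.
move=> SA Sw sY; rewrite !wformE //; last exact: Ad_in_so SA sY.
rewrite (hadamard_Ad _ SA) // !(SO_on_Ad _ SA); congr (_ * _).
have AtA : A^T *m A = 1%:M by case: SA => /mulmx1C.
rewrite -!mulmxA (mulmxA A^T) AtA mul1mx mxtrace_mulC.
by rewrite -!mulmxA AtA mulmx1.
Qed.

Lemma wform_inner_product : inner_product_on_p wform.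
Proof.
have n2 : 0 < n%:R - 2 :> R by rewrite subr_gt0 ltr_nat.
split=> [a X Y Z _ _ _|X Y _ _|X /(in_pP _ n_gt2)[sX X0] nX].
- rewrite /wform mulrCA -mulrDr; congr (_ * _).
  rewrite mulr_sumr -big_split; apply: eq_bigr => i _ /=.
  rewrite mulr_sumr -big_split; apply: eq_bigr => j _ /=.
  by rewrite !mxE; ring.
- by congr (_ * _); do 2!(apply: eq_bigr => ? _); rewrite [_ * Y _ _]mulrC.
rewrite /wform mulr_gt0 // lt_def; apply/andP; split; last first.
  apply: sumr_ge0 => i _; apply: sumr_ge0 => j _.
  rewrite mulr_ge0 ?sqr_ge0 //; case: (boolP (lower i && lower j)) => ij.
    by rewrite w_lower.
  exact: ltW (w_gt0 ij).
apply: contra nX => /eqP/psumr_eq0P s0; apply/eqP/matrixP => i j; rewrite [RHS]mxE.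
have ge0 k l : 0 <= w k l * (X k l * X k l).
  rewrite mulr_ge0 ?sqr_ge0 //; case: (boolP (lower k && lower l)) => kl.
    by rewrite w_lower.
  exact: ltW (w_gt0 kl).
have [ij|ij] := boolP (lower i && lower j); first exact: X0.
have si : \sum_l w i l * (X i l * X i l) = 0.
  by apply: s0 => // k _; apply: sumr_ge0.
have sj := psumr_eq0P (fun l _ => ge0 i l) si.
by move: (sj j isT) => /eqP; rewrite mulf_eq0 gt_eqF ?w_gt0 //= mulf_eq0 orbb => /eqP.
Qed.

Lemma lc_coef_lower i j k : lower i && lower j -> lc_coef i k j = 0.
Proof.
by move=> ij; rewrite /lc_coef (w_lower ij) invr0 mulr0 /in_pair ij addr0 mul0r.
Qed.

Lemma tbracket_lc_in_p X Y : in_so X -> in_so Y -> in_p (tbracket lc_coef X Y).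
Proof.
move=> sX sY; apply/(in_pP _ n_gt2); split; first exact: tbracket_skew.
move=> i j ij; rewrite mxE big1 // => k _.
by rewrite !lc_coef_lower ?mul0r ?subrr // andbC.
Qed.

Lemma lc_torsion_free X Y :
  tbracket lc_coef X Y - tbracket lc_coef Y X - pr_p (bracket X Y) = 0.
Proof.
apply/eqP; rewrite subr_eq0 pr_p_bracketE; apply/eqP/matrixP => i j.
rewrite !mxE -sumrB; apply: eq_bigr => k _; rewrite /lc_coef.
have -> : in_pair R j i = in_pair R i j by rewrite /in_pair andbC.
by rewrite (wC k i) (wC j k) (wC j i); move: (w i j)^-1 => v; field.
Qed.

(** With a i k j = (w i j + w k j - w i k) / 2, the first summand is a multiple
    of the sum of a i k j * (X i k * Y k j * Z i j). Exchanging Y and Z amounts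
    to exchanging i and k, which fixes a and changes the sign of X i k. *)
Lemma wform_lc_metric X Y Z : in_p X -> in_p Y -> in_p Z ->
  wform (tbracket lc_coef X Y) Z + wform Y (tbracket lc_coef X Z) = 0.
Proof.
move=> /(in_pP _ n_gt2)[sX _] /(in_pP _ n_gt2)[sY Y0] /(in_pP _ n_gt2)[sZ Z0].
pose a i k j : R := (w i j + w k j - w i k) / 2.
have half U V : in_so U -> in_p V ->
    \sum_i \sum_j w i j * (tbracket lc_coef X U i j * V i j)
    = 2 * \sum_i \sum_j \sum_k a i k j * (X i k * U k j * V i j).
  move=> sU /(in_pP _ n_gt2)[sV V0].
  have wV i k j : w i j * lc_coef i k j * V i j = a i k j * V i j.
    case: (boolP (lower i && lower j)) => ij; first by rewrite V0 // !mulr0.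
    have w0 : w i j != 0 by rewrite gt_eqF ?w_gt0.
    by congr (_ * _); rewrite /lc_coef /a /in_pair ij mulr1n; field.
  transitivity (\sum_i \sum_j \sum_k a i k j * (X i k * U k j * V i j)
     - \sum_i \sum_j \sum_k a j k i * (U i k * X k j * V i j)).
    rewrite -sumrB; apply: eq_bigr => i _; rewrite -sumrB; apply: eq_bigr => j _.
    rewrite mxE mulr_suml mulr_sumr -sumrB; apply: eq_bigr => k _.
    have wV' : w i j * lc_coef j k i * V i j = a j k i * V i j.
      by rewrite (in_soE j i sV) wC !mulrN wV.
    transitivity (w i j * lc_coef i k j * V i j * (X i k * U k j)
      - w i j * lc_coef j k i * V i j * (U i k * X k j)); first by ring.
    by rewrite wV wV'; ring.
  rewrite [X in _ - X]exchange_big /= mulr2n mulrDl mul1r; congr (_ + _).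
  rewrite -sumrN; apply: eq_bigr => i _; rewrite -sumrN; apply: eq_bigr => j _.
  rewrite -sumrN; apply: eq_bigr => k _.
  by rewrite (in_soE k j sU) (in_soE i k sX) (in_soE i j sV); ring.
rewrite /wform -mulrDr half //; last by apply/(in_pP _ n_gt2).
have -> : \sum_i \sum_j w i j * (Y i j * tbracket lc_coef X Z i j)
    = \sum_i \sum_j w i j * (tbracket lc_coef X Z i j * Y i j).
  by do 2!(apply: eq_bigr => ? _); rewrite [Y _ _ * _]mulrC.
rewrite half //; last by apply/(in_pP _ n_gt2).
rewrite -mulrDr [X in 2 * X](_ : _ = 0) ?mulr0 //.
apply/eqP; rewrite addr_eq0 -sumrN; apply/eqP.
under eq_bigr do rewrite exchange_big.
rewrite exchange_big /=; apply: eq_bigr => k _; rewrite -sumrN exchange_big /=.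
apply: eq_bigr => j _; rewrite -sumrN; apply: eq_bigr => i _.
by rewrite (in_soE i k sX) /a (wC k i); ring.
Qed.

End Weighted.

(** * Einstein equations of diagonal metrics *)

Section Einstein.
Variables (R : realType) (n : nat) (w : 'I_n -> 'I_n -> R).
Hypothesis n_gt2 : (2 < n)%N.
Hypothesis wC : forall i j, w i j = w j i.
Hypothesis w_lower : forall i j, lower i && lower j -> w i j = 0.
Hypothesis w_gt0 : forall i j, ~~ (lower i && lower j) -> 0 < w i j.
Implicit Types (X Y Z A : 'M[R]_n) (i j k : 'I_n).

Variable Q : 'M[R]_n -> 'M[R]_n -> R.
Hypothesis QE : forall X Y, in_p X -> in_p Y -> Q X Y = wform w X Y.

Lemma in_p_linear a X Y : in_p X -> in_p Y -> in_p (a *: X + Y).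
Proof.
move=> /(in_pP _ n_gt2)[sX X0] /(in_pP _ n_gt2)[sY Y0]; apply/(in_pP _ n_gt2).
split=> [|i j ij]; first by rewrite /in_so raddfD /= linearZ /= sX sY scalerN opprD.
by rewrite !mxE X0 ?Y0 // mulr0 addr0.
Qed.

Lemma weighted_inner_product : inner_product_on_p Q.
Proof.
have [linQ symQ posQ] := wform_inner_product n_gt2 w_lower w_gt0.
split=> [a X Y Z pX pY pZ|X Y pX pY|X pX].
- by rewrite !QE //; [exact: linQ|exact: in_p_linear].
- by rewrite !QE //; exact: symQ.
by rewrite QE //; exact: posQ.
Qed.

Lemma weighted_Ad_invariant S A X Y : SO_on S A -> constant_on S w ->
  in_p X -> in_p Y -> Q (Ad A X) (Ad A Y) = Q X Y.
Proof.
move=> SA Sw pX pY; rewrite !QE //; try exact: Ad_in_p SA Sw _.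
by apply: wform_Ad SA Sw _; case/(in_pP _ n_gt2): pY.
Qed.

Hypothesis w_constant_on_lower : constant_on (@lower n) w.

Lemma weighted_levi_civita : levi_civita Q (tbracket (lc_coef w)).
Proof.
have soP X : in_p X -> in_so X by case/(in_pP _ n_gt2).
split=> [X Y pX pY|a X Y Z _ _ _|a X Y Z _ _ _|A X Y HA _ _|X Y _ _|X Y Z pX pY pZ].
- by apply: tbracket_lc_in_p => //; apply: soP.
- exact: tbracket_linear_l.
- exact: tbracket_linear_r.
- have wV : constant_on (@lower n) (fun i j => (w i j)^-1).
    case: w_constant_on_lower => _ wS; split=> [i j|a i b Sa Si].
      by rewrite wC.
    by rewrite (wS a i b).
  have we := constant_on_in_pair wC w_lower w_gt0 w_constant_on_lower.
  have hA f U : constant_on (@lower n) f ->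
    hadamard f (Ad A U) = Ad A (hadamard f U) by apply: hadamard_Ad HA.
  rewrite !tbracket_lcE // !hA // !(bracket_Ad _ _ HA).
  have AdB U V : Ad A U - Ad A V = Ad A (U - V).
    by rewrite /Ad -mulmxBl -mulmxBr.
  rewrite AdB !hA // /Ad -!mulmxDl -!mulmxDr.
  by rewrite -scalemxAr -scalemxAl.
- exact: lc_torsion_free.
rewrite !QE //; try by apply: tbracket_lc_in_p => //; apply: soP.
exact: wform_lc_metric.
Qed.

(** [ricci_term] is not symmetric in i and k, but Y i k * Z i k is, so only the
    symmetrization enters the Ricci form. *)
Definition ricci_sym i k j : R :=
  (ricci_term (lc_coef w) i k j + ricci_term (lc_coef w) k i j) / 2.

Lemma weighted_einstein (mu : R) :
  (forall i k, i != k -> ~~ (lower i && lower k) ->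
     \sum_(j | (j != i) && (j != k)) ricci_sym i k j = mu * w i k) ->
  einstein Q.
Proof.
move=> ric; exists (tbracket (lc_coef w)); split; first exact: weighted_levi_civita.
have n2 : n%:R - 2 != 0 :> R by rewrite subr_eq0 eqr_nat gtn_eqF.
exists (mu / (n%:R - 2)) => Y Z pY pZ; rewrite QE //.
have [sY Y0] := (in_pP _ n_gt2).1 pY; have [sZ Z0] := (in_pP _ n_gt2).1 pZ.
rewrite ricci_tbracket //; last by move=> i j k; apply: lc_coef_lower.
rewrite /wform mulrA divfK //.
pose r i k := \sum_(j | (j != i) && (j != k)) ricci_term (lc_coef w) i k j.
pose y i k := Y i k * Z i k.
have yC i k : y k i = y i k.
  by rewrite /y (in_soE i k sY) (in_soE i k sZ); ring.
have y0 i : y i i = 0 by rewrite /y (in_so_diag i sY) mul0r.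
have full (F : 'I_n -> 'I_n -> R) : \sum_i \sum_(k | k != i) F i k * y i k
    = \sum_i \sum_k F i k * y i k.
  by apply: eq_bigr => i _; rewrite [RHS](bigD1 i) //= y0 mulr0 add0r.
have swap : \sum_i \sum_k r i k * y i k = \sum_i \sum_k r k i * y i k.
  rewrite exchange_big; apply: eq_bigr => i _; apply: eq_bigr => k _.
  by rewrite yC.
rewrite -/(y _ _) (full r).
transitivity (\sum_i \sum_k (r i k + r k i) / 2 * y i k).
  apply: (mulfI (_ : 2 != 0)); first by rewrite pnatr_eq0.
  rewrite mulr2n mulrDl mul1r {2}swap -big_split mulr_sumr.
  apply: eq_bigr => i _; rewrite -big_split mulr_sumr; apply: eq_bigr => k _ /=.
  by field.
rewrite mulr_sumr; apply: eq_bigr => i _; rewrite mulr_sumr; apply: eq_bigr => k _.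
have [->|ik] := eqVneq i k; first by rewrite -/(y k k) y0 !mulr0.
have [lik|lik] := boolP (lower i && lower k).
  by rewrite /y Y0 // mul0r !mulr0.
rewrite mulrA -ric //; congr (_ * _); rewrite /r.
rewrite [X in _ + X](eq_bigl (fun j => (j != i) && (j != k))); last first.
  by move=> j; rewrite andbC.
by rewrite -big_split mulr_suml.
Qed.

Lemma ricci_sym_lower i k j : ~~ (lower i && lower k) ->
  lower j -> lower i || lower k -> ricci_sym i k j = 1 / 2.
Proof.
move=> ik lj ik'; rewrite /ricci_sym /ricci_term.
wlog lk : i k ik ik' / lower k.
  move=> H; case/orP: (ik') => [li|lk]; last exact: H.
  by rewrite addrC; apply: H => //; rewrite 1?andbC 1?orbC.
have li : lower i = false by move: ik; rewrite lk andbT => /negbTE.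
have low a b c : lower a -> lower b -> lc_coef w a c b = 0.
  by move=> la lb; rewrite (lc_coef_lower w_lower) ?la.
rewrite (low j k i) // (low k j i) // /in_pair li lk lj /= mulr0n mulr1n.
by ring.
Qed.

(** On a triangle without lower edge, the curvature of h does not contribute and
    this is the usual formula in terms of the three weights. *)
Lemma ricci_sym_gt0 i k j : ~~ (lower i && lower k) ->
  ~~ (lower i && lower j) -> ~~ (lower k && lower j) ->
  ricci_sym i k j = 1 / 2 +
    (w i k ^+ 2 - w i j ^+ 2 - w k j ^+ 2) / (4 * (w i j * w k j)).
Proof.
move=> ik ij kj; rewrite /ricci_sym /ricci_term /lc_coef /in_pair.
rewrite [lower j && lower i]andbC [lower j && lower k]andbC ij kj mulr1n.
rewrite (wC k i) (wC j i) (wC j k); field.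
by rewrite !gt_eqF ?w_gt0.
Qed.

End Einstein.


Section Blocks.
Variables (R : realType) (n k1 k2 : nat).
Hypothesis k12 : (k1 + k2 = 5)%N.
Hypothesis n_gt5 : (5 < n)%N.

Definition block_weight (x1 x2 x12 x13 x23 : R) (b c : nat) : R :=
  match b, c with
  | 1, 1 => x1 | 2, 2 => x2 | 1, 2 | 2, 1 => x12
  | 1, 3 | 3, 1 => x13 | 2, 3 | 3, 2 => x23 | _, _ => 0
  end.

Lemma block_weightC x1 x2 x12 x13 x23 b c :
  block_weight x1 x2 x12 x13 x23 b c = block_weight x1 x2 x12 x13 x23 c b.
Proof. by case: b c => [|[|[|[|b]]]] [|[|[|[|c]]]]. Qed.

Lemma lower_blk (i : 'I_n) : lower i = (blk k1 k2 i == 3).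
Proof.
rewrite /lower /blk k12; case: (ltnP i k1) => ik1; last by case: (ltnP i 5).
by rewrite leqNgt (leq_trans ik1) // -k12 leq_addr.
Qed.

Lemma blk_cases (i : 'I_n) :
  [\/ blk k1 k2 i = 1%N, blk k1 k2 i = 2%N | blk k1 k2 i = 3%N].
Proof.
by rewrite /blk; case: ifP => _; [|case: ifP => _];
  [constructor 1|constructor 2|constructor 3].
Qed.

Lemma sum_blk (F : nat -> R) : \sum_(j < n) F (blk k1 k2 j)
  = k1%:R * F 1%N + k2%:R * F 2%N + (n%:R - 5) * F 3.
Proof.
pose f j := F (if (j < k1)%N then 1%N else if (j < k1 + k2)%N then 2%N else 3%N).
have le1 : (k1 <= k1 + k2)%N by rewrite leq_addr.
have le2 : (k1 + k2 <= n)%N by rewrite k12 ltnW.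
rewrite -(big_mkord xpredT f) (@big_cat_nat _ _ _ (k1 + k2)) //=.
rewrite (@big_cat_nat _ _ _ k1) //=; congr (_ + _ + _).
- rewrite (eq_big_nat _ _ (F2 := fun=> F 1%N)) => [|j /andP[_ jk]].
    by rewrite big_const_nat subn0 iter_addr_0 mulr_natl.
  by rewrite /f jk.
- rewrite (eq_big_nat _ _ (F2 := fun=> F 2%N)) => [|j /andP[kj jk]].
    by rewrite big_const_nat addKn iter_addr_0 mulr_natl.
  by rewrite /f ltnNge kj jk.
rewrite (eq_big_nat _ _ (F2 := fun=> F 3)) => [|j /andP[kj jn]].
  by rewrite big_const_nat iter_addr_0 k12 -[F 3 *+ _]mulr_natl (natrB R (ltnW n_gt5)).
by rewrite /f !ltnNge kj (leq_trans le1 kj).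
Qed.

Definition block_ricci_term (W : nat -> nat -> R) (b c d : nat) : R :=
  if (d == 3) && ((b == 3) || (c == 3)) then 1 / 2
  else 1 / 2 + (W b c ^+ 2 - W b d ^+ 2 - W c d ^+ 2) / (4 * (W b d * W c d)).

(** The coefficient of the Ricci form on the block (b, c): the third index runs
    over the k1, k2 and n - 5 indices of the blocks, except for the two that
    are taken by the edge itself. *)
Definition block_ricci (W : nat -> nat -> R) (b c : nat) : R :=
  let r := block_ricci_term W b c in
  k1%:R * r 1%N + k2%:R * r 2%N + (n%:R - 5) * r 3 - r b - r c.

Variables x1 x2 x12 x13 x23 : R.
Hypothesis x_gt0 : [/\ 0 < x1, 0 < x2, 0 < x12, 0 < x13 & 0 < x23].

Let W := block_weight x1 x2 x12 x13 x23.
Let w (i j : 'I_n) : R := W (blk k1 k2 i) (blk k1 k2 j).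

Let wC i j : w i j = w j i. Proof. exact: block_weightC. Qed.

Lemma block_weight_lower i j : lower i && lower j -> w i j = 0.
Proof. by rewrite !lower_blk /w => /andP[/eqP-> /eqP->]. Qed.

Lemma block_weight_gt0 i j : ~~ (lower i && lower j) -> 0 < w i j.
Proof.
case: x_gt0 => ? ? ? ? ?; rewrite !lower_blk /w.
by case: (blk_cases i) => ->; case: (blk_cases j) => ->.
Qed.

Lemma constant_on_block (S : pred 'I_n) :
  (forall i j, S i -> S j -> blk k1 k2 i = blk k1 k2 j) -> constant_on S w.
Proof. by move=> Sb; split=> // a i b Sa Si; rewrite /w (Sb a i). Qed.

Lemma block_einstein (mu : R) (Q : 'M[R]_n -> 'M[R]_n -> R) :
  (forall X Y, in_p X -> in_p Y -> Q X Y = wform w X Y) ->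
  (forall i k : 'I_n, i != k -> ~~ (lower i && lower k) ->
    block_ricci W (blk k1 k2 i) (blk k1 k2 k)
      = mu * W (blk k1 k2 i) (blk k1 k2 k)) ->
  invariant_metric Q /\ einstein Q.
Proof.
have n2 : (2 < n)%N by apply: leq_trans n_gt5.
have w_low : constant_on (@lower n) w.
  by apply: constant_on_block => i j; rewrite !lower_blk => /eqP-> /eqP->.
move=> QE ric; split; first split.
- exact: (weighted_inner_product n2 block_weight_lower block_weight_gt0 QE).
- by move=> A X Y HA; apply: (weighted_Ad_invariant n2 wC block_weight_lower block_weight_gt0 QE HA).
apply: (weighted_einstein n2 wC block_weight_lower block_weight_gt0 QE w_low (mu := mu)).
move=> i k ik lik; rewrite -[RHS]ric // /block_ricci.
set r := block_ricci_term W _ _.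
have rE j : (j != i) && (j != k) -> ricci_sym w i k j = r (blk k1 k2 j).
  move=> _; rewrite /r /block_ricci_term -!lower_blk.
  have [lj|lj] /= := boolP (lower j); last first.
    by apply: (ricci_sym_gt0 wC block_weight_gt0); rewrite ?(negPf lj) ?andbF.
  case: ifP => [|/norP[li lk]]; first exact: (ricci_sym_lower block_weight_lower).
  by apply: (ricci_sym_gt0 wC block_weight_gt0); rewrite ?(negPf li) ?(negPf lk).
rewrite (eq_bigr _ rE) -(sum_blk r) [in RHS](bigD1 i) //=.
rewrite [in RHS](bigD1 k) 1?eq_sym //=.
by ring.
Qed.

End Blocks.

(** * The Einstein equations for blocks (1,4,n-5) and (2,3,n-5) *)

(** Write z = x2, v = x12, u = x13, w = x23 and m = n - 5, and let r_bc be the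
    Ricci coefficients.
    For (1,4,m), the equation r_13 = mu * u gives mu = M / (2 u v w), and
    r_23 = mu * w then gives z = w N / (3 u v). What remains is r_12 = mu * v,
    which becomes [mixed_1_4] = 0, and r_22 = mu * z, which becomes
    [so4_1_4] = 0.
    For (2,3,m) there is also y = x1. Let k = 3 u^2 + m v^2 and K = k + v^2.
    The equation of so(2) says mu = k y / (4 u^2 v^2); those of m_13 and m_23
    then give y = u v T / (w K) and z = w N / (2 u v K), hence
    mu = k T / (4 u v w K), and the equations of m_12 and so(3) become
    [mixed_2_3] = 0 and [so3_2_3] = 0. *)
Section Systems.
Local Open Scope expr_scope.
Let u := Var 0. Let v := Var 1. Let w := Var 2. Let m := Var 3.

Definition M_1_4 : expr :=
  (m + 3) * v * w + 2 * (u ^+ 2 - v ^+ 2 - w ^+ 2).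
Definition N_1_4 : expr :=
  2 * (m + 3) * v * (u - w) + 5 * (w ^+ 2 - u ^+ 2) + 3 * v ^+ 2.
Definition mixed_1_4 : expr :=
  v ^+ 2 * (2 * (m + 3) * u * w + m * (v ^+ 2 - u ^+ 2 - w ^+ 2) - 2 * M_1_4)
  - w ^+ 2 * N_1_4.
Definition so4_1_4 : expr :=
  (w ^+ 2 + m * v ^+ 2) * N_1_4 ^+ 2 - 6 * v ^+ 2 * M_1_4 * N_1_4
  + 18 * u ^+ 2 * v ^+ 4.

Definition T_2_3 : expr := 2 * (m + 3) * v * w + 3 * (u ^+ 2 - v ^+ 2 - w ^+ 2).
Definition k_2_3 : expr := 3 * u ^+ 2 + m * v ^+ 2.
Definition K_2_3 : expr := k_2_3 + v ^+ 2.
Definition N_2_3 : expr :=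
  2 * K_2_3 * ((m + 3) * u * v + w ^+ 2 - v ^+ 2 - u ^+ 2) - k_2_3 * T_2_3.
Definition mixed_2_3 : expr :=
  (2 * (m + 3) * u * w * v ^+ 2 + m * v ^+ 2 * (v ^+ 2 - u ^+ 2 - w ^+ 2)) * K_2_3
  - u ^+ 2 * v ^+ 2 * T_2_3 - w ^+ 2 * N_2_3 - k_2_3 * v ^+ 2 * T_2_3.
Definition so3_2_3 : expr :=
  (2 * w ^+ 2 + m * v ^+ 2) * N_2_3 ^+ 2 + 4 * u ^+ 2 * v ^+ 4 * K_2_3 ^+ 2
  - 2 * v ^+ 2 * k_2_3 * T_2_3 * N_2_3.


(** The boxes follow the solutions as m varies. For large m there are solutions
    with w = 1 near (u, v) = (1 - 3 / m, 2 - 5 / m) and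
    (1 + 1.38 / m^2, 2.25 / m) for (1,4,m), and near
    (1 - 2 / m, 2 - 4.5 / m) and (1 + 1.25 / m^2, 2.04 / m) for (2,3,m).
    The bounds are simple fractions in m around the numerical solutions that
    are valid down to m = 2; Jensen's metrics, which have u = w, are outside.
    On a side u = const, the multipliers c0 and c1 approximate the ratio of the
    v-derivatives of the two equations near the solution; subtracting the
    multiple of f removes most of the dependence on v, and an expression of
    constant sign remains. *)
Let p : expr := Var 0.

(* u / w in [(2m-3)/(2m+3), (2m+1)/(2m+3)], v / w in [2m/(m+3), (2m+2)/(m+3)] *)
Definition box_1_4_lt :=
  Box ((2 * p - 3) * (p + 3)) ((2 * p + 1) * (p + 3))
    (2 * p * (2 * p + 3)) ((2 * p + 2) * (2 * p + 3))
    ((2 * p + 3) * (p + 3)).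

(* u / w in [(m-1)/(m+1), m/(m+1)], v / w in [(4m+1)/(2m+6), (4m+4)/(2m+6)] *)
Definition box_2_3_lt :=
  Box ((p - 1) * (2 * p + 6)) (p * (2 * p + 6))
    ((4 * p + 1) * (p + 1)) ((4 * p + 4) * (p + 1))
    ((p + 1) * (2 * p + 6)).

(* u / w in [1 + 1/(4m(m+2)), 1 + 5/(2m(m+2))], v / w in [3/(2m+4), 3/(m+2)];
   this box serves for both decompositions. *)
Definition box_gt :=
  Box (4 * p * (p + 2) + 1) (4 * p * (p + 2) + 10) (6 * p) (12 * p)
    (4 * p * (p + 2)).

Lemma certificate_1_4_lt : certified box_1_4_lt mixed_1_4 (- so4_1_4)
  0 (- (5 * v ^+ 2 + 4 * (u - w) * w * m ^+ 2)) 4 6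
  [:: (M_1_4, 2%N); (u, 1%N); (v, 1%N); (w, 1%N); (w - u, 1%N)].
Proof. by vm_compute. Qed.

Lemma certificate_1_4_gt : certified box_gt (- mixed_1_4) so4_1_4
  (- (8 * v ^+ 2)) (- (8 * v ^+ 2)) 4 6
  [:: (M_1_4, 2%N); (u, 1%N); (v, 1%N); (w, 1%N); (u - w, 1%N)].
Proof. by vm_compute. Qed.

Lemma certificate_2_3_lt : certified box_2_3_lt mixed_2_3 (- so3_2_3)
  (- (6 * w ^+ 4 * m)) (3 * w ^+ 4 * m) 6 10
  [:: (T_2_3, 2%N); (u, 1%N); (v, 1%N); (w, 1%N); (w - u, 1%N)].
Proof. by vm_compute. Qed.

Lemma certificate_2_3_gt : certified box_gt (- mixed_2_3) so3_2_3
  (- (2 * v ^+ 3 * w * (m + 2))) (- (8 * v ^+ 3 * w * (m + 2))) 6 10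
  [:: (T_2_3, 2%N); (u, 1%N); (v, 1%N); (w, 1%N); (u - w, 1%N)].
Proof. by vm_compute. Qed.

End Systems.

Lemma pos_of_quadratic (R : realType) (a b c x : R) :
  0 <= a -> 0 < b -> 0 < c -> a * x ^+ 2 - b * x + c = 0 -> 0 < x.
Proof.
move=> a0 b0 c0 e; rewrite -(pmulr_rgt0 _ b0).
have := mulr_ge0 a0 (sqr_ge0 x); lra.
Qed.

(** The weight of so(1) = 0 is arbitrary. *)
Definition einstein_weights_1_4 (R : realType) (n : nat) (z v u w : R) : Prop :=
  [/\ 0 < z, 0 < v, 0 < u & 0 < w] /\
  let W := block_weight 1 z v u w in
  exists mu, forall b c, (b, c) \in [:: (1, 2); (2, 2); (1, 3); (2, 3)]%N ->
    block_ricci n 1 4 W b c = mu * W b c.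

Definition einstein_weights_2_3 (R : realType) (n : nat) (y z v u w : R) :
    Prop :=
  [/\ 0 < y, 0 < z, 0 < v, 0 < u & 0 < w] /\
  let W := block_weight y z v u w in
  exists mu, forall b c,
    (b, c) \in [:: (1, 1); (1, 2); (2, 2); (1, 3); (2, 3)]%N ->
    block_ricci n 2 3 W b c = mu * W b c.
Section Solve.
Variables (R : realType) (n : nat).
Hypothesis n_gt6 : (6 < n)%N.
Let m : R := n%:R - 5.

Let m_gt0 : 0 < m. Proof. by rewrite subr_gt0 ltr_nat (leq_trans _ n_gt6). Qed.

Lemma block_ricciC k1 k2 (x1 x2 x12 x13 x23 : R) b c :
  let W := block_weight x1 x2 x12 x13 x23 in
  block_ricci n k1 k2 W b c = block_ricci n k1 k2 W c b.
Proof.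
move=> W; have rC d : block_ricci_term W b c d = block_ricci_term W c b d.
  rewrite /block_ricci_term orbC (block_weightC _ _ _ _ _ b c : W b c = W c b).
  by rewrite [W b d * _]mulrC addrAC.
by rewrite /block_ricci !rC; ring.
Qed.

(** Positivity of z is automatic: the equation of so(4) is a quadratic equation
    for N whose coefficients allow only positive roots when M > 0. *)
Lemma system_1_4 (u v w : R) : 0 < u -> 0 < v -> 0 < w ->
  let e := [:: u; v; w; m; 1] in
  interp e mixed_1_4 = 0 -> interp e so4_1_4 = 0 -> 0 < interp e M_1_4 ->
  exists z, einstein_weights_1_4 n z v u w.
Proof.
move=> u0 v0 w0 e.
have un : u != 0 by rewrite gt_eqF.
have vn : v != 0 by rewrite gt_eqF.
have wn : w != 0 by rewrite gt_eqF.
pose N := interp e N_1_4; pose M := interp e M_1_4.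
have NE : N = 2 * (m + 3) * v * (u - w) + 5 * (w ^+ 2 - u ^+ 2) + 3 * v ^+ 2.
  by rewrite /N /=; ring.
have ME : M = (m + 3) * v * w + 2 * (u ^+ 2 - v ^+ 2 - w ^+ 2).
  by rewrite /M /=; ring.
have -> : interp e mixed_1_4 = v ^+ 2 * (2 * (m + 3) * u * w
    + m * (v ^+ 2 - u ^+ 2 - w ^+ 2) - 2 * M) - w ^+ 2 * N.
  by rewrite /N /M /=; ring.
have -> : interp e so4_1_4 = (w ^+ 2 + m * v ^+ 2) * N ^+ 2 - 6 * v ^+ 2 * M * N
    + 18 * u ^+ 2 * v ^+ 4 by rewrite /N /M /=; ring.
rewrite -/M => F0 G0 M0.
have N0 : 0 < N.
  apply: pos_of_quadratic G0; last by rewrite !mulr_gt0 ?exprn_gt0.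
    by rewrite addr_ge0 ?sqr_ge0 // mulr_ge0 ?sqr_ge0 // ltW.
  by rewrite !mulr_gt0 ?exprn_gt0.
have Nn : N != 0 by rewrite gt_eqF.
exists (w * N / (3 * u * v)); split; first by rewrite divr_gt0 ?mulr_gt0.
move=> W; exists (M / (2 * u * v * w)) => b c.
rewrite !inE => /or4P[] /eqP[-> ->]; apply/eqP; rewrite -subr_eq0; apply/eqP;
  rewrite /block_ricci /block_ricci_term /W /= -/m.
- transitivity ((v ^+ 2 * (2 * (m + 3) * u * w
    + m * (v ^+ 2 - u ^+ 2 - w ^+ 2) - 2 * M) - w ^+ 2 * N)
      / (4 * u * v ^+ 2 * w)); last by rewrite F0 mul0r.
  by field; rewrite un vn wn Nn.
- transitivity (((w ^+ 2 + m * v ^+ 2) * N ^+ 2 - 6 * v ^+ 2 * M * N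
    + 18 * u ^+ 2 * v ^+ 4) / (36 * u ^+ 2 * v ^+ 4)); last by rewrite G0 mul0r.
  by field; rewrite un vn wn Nn.
- by rewrite ME; field; rewrite un vn wn.
- rewrite ME; rewrite NE in Nn *.
  by field; rewrite un vn wn Nn.
Qed.

Lemma system_2_3 (u v w : R) : 0 < u -> 0 < v -> 0 < w ->
  let e := [:: u; v; w; m; 1] in
  interp e mixed_2_3 = 0 -> interp e so3_2_3 = 0 -> 0 < interp e T_2_3 ->
  exists y z, einstein_weights_2_3 n y z v u w.
Proof.
move=> u0 v0 w0 e.
have un : u != 0 by rewrite gt_eqF.
have vn : v != 0 by rewrite gt_eqF.
have wn : w != 0 by rewrite gt_eqF.
pose N := interp e N_2_3; pose T := interp e T_2_3.
pose k := 3 * u ^+ 2 + m * v ^+ 2; pose K := k + v ^+ 2.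
have k0 : 0 < k by rewrite addr_gt0 ?mulr_gt0 ?exprn_gt0.
have K0 : 0 < K by rewrite addr_gt0 ?exprn_gt0.
have Kn : K != 0 by rewrite gt_eqF.
have TE : T = 2 * (m + 3) * v * w + 3 * (u ^+ 2 - v ^+ 2 - w ^+ 2).
  by rewrite /T /=; ring.
have NE : N = 2 * K * ((m + 3) * u * v + w ^+ 2 - v ^+ 2 - u ^+ 2) - k * T.
  by rewrite /N /T /K /k /=; ring.
have -> : interp e mixed_2_3 = (2 * (m + 3) * u * w * v ^+ 2
    + m * v ^+ 2 * (v ^+ 2 - u ^+ 2 - w ^+ 2)) * K
    - u ^+ 2 * v ^+ 2 * T - w ^+ 2 * N - k * v ^+ 2 * T.
  by rewrite /N /T /K /k /=; ring.
have -> : interp e so3_2_3 = (2 * w ^+ 2 + m * v ^+ 2) * N ^+ 2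
    - 2 * v ^+ 2 * k * T * N + 4 * u ^+ 2 * v ^+ 4 * K ^+ 2.
  by rewrite /N /T /K /k /=; ring.
rewrite -/T => F0 G0 T0.
have N0 : 0 < N.
  apply: pos_of_quadratic G0; last by rewrite !mulr_gt0 ?exprn_gt0.
    by rewrite addr_ge0 // mulr_ge0 ?sqr_ge0 // ltW.
  by rewrite !mulr_gt0 ?exprn_gt0.
have Nn : N != 0 by rewrite gt_eqF.
have Tn : T != 0 by rewrite gt_eqF.
exists (u * v * T / (w * K)), (w * N / (2 * u * v * K)).
split; first by split; rewrite ?divr_gt0 ?mulr_gt0.
move=> W; exists (k * T / (4 * u * v * w * K)) => b c.
rewrite !inE => /or4P[|||/orP[]] /eqP[-> ->]; apply/eqP; rewrite -subr_eq0;
  apply/eqP; rewrite /block_ricci /block_ricci_term /W /= -/m.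
- rewrite /k; field.
  by rewrite un vn wn Tn Kn.
- transitivity (((2 * (m + 3) * u * w * v ^+ 2
    + m * v ^+ 2 * (v ^+ 2 - u ^+ 2 - w ^+ 2)) * K
    - u ^+ 2 * v ^+ 2 * T - w ^+ 2 * N - k * v ^+ 2 * T)
      / (4 * u * v ^+ 2 * w * K)); last by rewrite F0 mul0r.
  by field; rewrite un vn wn Nn Tn Kn.
- transitivity (((2 * w ^+ 2 + m * v ^+ 2) * N ^+ 2
    - 2 * v ^+ 2 * k * T * N + 4 * u ^+ 2 * v ^+ 4 * K ^+ 2)
      / (16 * u ^+ 2 * v ^+ 4 * K ^+ 2)); last by rewrite G0 mul0r.
  by field; rewrite un vn wn Nn Kn.
- rewrite TE in Tn *; rewrite /K /k in Kn *.
  by field; rewrite un vn wn Kn Tn.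
- rewrite NE TE in Nn *; rewrite /K /k in Kn Nn *.
  by field; rewrite un vn wn Kn Nn.
Qed.

End Solve.

(** * The invariant metrics of the theorem *)

Section Metrics.
Variables (R : realType) (n : nat).
Hypothesis n_gt6 : (6 < n)%N.
Let n_gt2 : (2 < n)%N. Proof. exact: leq_trans n_gt6. Qed.
Let n_gt5 : (5 < n)%N. Proof. exact: leq_trans n_gt6. Qed.
Implicit Types X Y : 'M[R]_n.

Definition between (k1 k2 b c : nat) (i j : 'I_n) : bool :=
  ((blk k1 k2 i == b) && (blk k1 k2 j == c))
  || ((blk k1 k2 i == c) && (blk k1 k2 j == b)).

Lemma wformD w1 w2 X Y :
  wform w1 X Y + wform w2 X Y = wform (fun i j => w1 i j + w2 i j) X Y.
Proof.
rewrite /wform -mulrDr -big_split; congr (_ * _); apply: eq_bigr => i _ /=.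
by rewrite -big_split; apply: eq_bigr => j _ /=; rewrite mulrDl.
Qed.

Lemma negB_wform k1 k2 b c (x : R) X Y : in_so X -> in_so Y ->
  x * negB k1 k2 b c X Y = wform (fun i j => x * (between k1 k2 b c i j)%:R) X Y.
Proof.
move=> sX sY; have bpE (Z : 'M[R]_n) : block_part k1 k2 b c Z
    = \matrix_(i, j) ((between k1 k2 b c i j)%:R * Z i j).
  by apply/matrixP => i j; rewrite !mxE -/(between _ _ _ _ i j); case: ifP;
    rewrite ?mul1r ?mul0r.
have bpS (Z : 'M[R]_n) : in_so Z -> in_so (block_part k1 k2 b c Z).
  move=> sZ; rewrite bpE; apply/matrixP => i j; rewrite !mxE (in_soE i j sZ).
  by rewrite /between orbC [in X in _ || X]andbC [X in X || _]andbC mulrN.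
rewrite /negB killingE; try exact: bpS.
rewrite -mulrN /wform mulrCA; congr (_ * _); rewrite mulrN -mulNr /mxtrace.
rewrite mulr_sumr; apply: eq_bigr => i _; rewrite mxE mulr_sumr.
apply: eq_bigr => j _; rewrite (in_soE i j (bpS Y sY)) !bpE !mxE.
by case: between; rewrite /= ?mulr1n ?mulr0n; ring.
Qed.

Lemma eq_wform w1 w2 X Y : (forall i j, X i j != 0 -> w1 i j = w2 i j) ->
  wform w1 X Y = wform w2 X Y.
Proof.
move=> w12; congr (_ * _); apply: eq_bigr => i _; apply: eq_bigr => j _.
by have [->|/w12->//] := eqVneq (X i j) 0; rewrite !mul0r !mulr0.
Qed.

Definition blk_weight k1 k2 (x1 x2 x12 x13 x23 : R) (i j : 'I_n) : R :=
  block_weight x1 x2 x12 x13 x23 (blk k1 k2 i) (blk k1 k2 j).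

(** The weight x1 only concerns the entry in row and column 0, which vanishes
    for a skew matrix. *)
Lemma metric_1_4E (x1 x2 x12 x13 x23 : R) X Y : in_p X -> in_p Y ->
  metric_1_4 x2 x12 x13 x23 X Y = wform (blk_weight 1 4 x1 x2 x12 x13 x23) X Y.
Proof.
move=> /(in_pP _ n_gt2)[sX X0] /(in_pP _ n_gt2)[sY _].
rewrite /metric_1_4 !negB_wform // !wformD; apply: eq_wform => i j Xij.
have : ~~ ((blk 1 4 i == 3) && (blk 1 4 j == 3)).
  by rewrite -!(@lower_blk n 1 4) //; apply: contra Xij => /X0->.
have : ~~ ((blk 1 4 i == 1%N) && (blk 1 4 j == 1%N)).
  apply: contra Xij => /andP[]; rewrite /blk.
  case: (ltnP i 1) => [i0 _|_]; last by case: ifP.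
  case: (ltnP j 1) => [j0 _|_]; last by case: ifP.
  have -> : i = j by apply: val_inj; move: i0 j0; rewrite /= !ltnS !leqn0 => /eqP-> /eqP->.
  by rewrite in_so_diag.
rewrite /between /blk_weight.
by case: (blk_cases 1 4 i) => ->; case: (blk_cases 1 4 j) => -> //= *; ring.
Qed.

Lemma metric_2_3E (x1 x2 x12 x13 x23 : R) X Y : in_p X -> in_p Y ->
  metric_2_3 x1 x2 x12 x13 x23 X Y = wform (blk_weight 2 3 x1 x2 x12 x13 x23) X Y.
Proof.
move=> /(in_pP _ n_gt2)[sX X0] /(in_pP _ n_gt2)[sY _].
rewrite /metric_2_3 !negB_wform // !wformD; apply: eq_wform => i j Xij.
have : ~~ ((blk 2 3 i == 3) && (blk 2 3 j == 3)).
  by rewrite -!(@lower_blk n 2 3) //; apply: contra Xij => /X0->.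
rewrite /between /blk_weight.
by case: (blk_cases 2 3 i) => ->; case: (blk_cases 2 3 j) => -> //= *; ring.
Qed.

Lemma jensen_metricE (a : R) X Y : in_p X -> in_p Y ->
  jensen_metric a X Y = wform (blk_weight 5 0 a 1 1 1 1) X Y.
Proof.
move=> /(in_pP _ n_gt2)[sX X0] /(in_pP _ n_gt2)[sY _].
rewrite /jensen_metric -[negB 5 0 1 3 X Y]mul1r !negB_wform // !wformD.
apply: eq_wform => i j Xij.
have no2 (l : 'I_n) : blk 5 0 l != 2%N.
  by rewrite /blk addn0; case: ifP => // ->.
move: (no2 i) (no2 j).
have : ~~ ((blk 5 0 i == 3) && (blk 5 0 j == 3)).
  by rewrite -!(@lower_blk n 5 0) //; apply: contra Xij => /X0->.
rewrite /between /blk_weight.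
by case: (blk_cases 5 0 i) => ->; case: (blk_cases 5 0 j) => -> //= *; ring.
Qed.

Lemma block_SO_invariant k1 k2 (x1 x2 x12 x13 x23 : R) Q : (k1 + k2 = 5)%N ->
  [/\ 0 < x1, 0 < x2, 0 < x12, 0 < x13 & 0 < x23] ->
  (forall X Y, in_p X -> in_p Y ->
    Q X Y = wform (blk_weight k1 k2 x1 x2 x12 x13 x23) X Y) ->
  Ad_invariant (in_block_SO k1 k2) Q.
Proof.
move=> k12 x0 QE _ X Y [A1 [A2 [A3 [SA1 SA2 SA3 ->]]]] pX pY.
have wC i j : blk_weight k1 k2 x1 x2 x12 x13 x23 i j
    = blk_weight k1 k2 x1 x2 x12 x13 x23 j i by exact: block_weightC.
have wl := block_weight_lower k12 x1 x2 x12 x13 x23 (n := n).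
have wp := block_weight_gt0 k12 x0 (n := n).
have const b : constant_on (fun i => blk k1 k2 i == b)
    (blk_weight k1 k2 x1 x2 x12 x13 x23).
  by apply: constant_on_block => i j /eqP-> /eqP->.
have AdM : forall Z, Ad (A1 *m A2 *m A3) Z = Ad A1 (Ad A2 (Ad A3 Z)).
  move=> Z; rewrite (SO_on_Ad _ SA1) (SO_on_Ad _ SA2) (SO_on_Ad _ SA3).
  have AV : invmx (A1 *m A2 *m A3) = (A1 *m A2 *m A3)^T.
    apply: orthogonal_invmx; case: SA1 SA2 SA3 => e1 _ _ [e2 _ _] [e3 _ _].
    by rewrite !trmx_mul -!mulmxA (mulmxA A3) e3 mul1mx (mulmxA A2) e2 mul1mx.
  by rewrite /Ad AV !trmx_mul !mulmxA.
have step S A U V : SO_on S A -> constant_on S (blk_weight k1 k2 x1 x2 x12 x13 x23) ->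
    in_p U -> in_p V -> [/\ in_p (Ad A U), in_p (Ad A V) & Q (Ad A U) (Ad A V) = Q U V].
  move=> SA Sw pU pV; split; try exact: (Ad_in_p n_gt2 wC wl wp SA Sw).
  exact: (weighted_Ad_invariant n_gt2 wC wl wp QE SA Sw).
have [pX3 pY3 E3] := step _ _ _ _ SA3 (const 3) pX pY.
have [pX2 pY2 E2] := step _ _ _ _ SA2 (const 2%N) pX3 pY3.
have [_ _ E1] := step _ _ _ _ SA1 (const 1%N) pX2 pY2.
by rewrite !AdM E1 E2.
Qed.

Lemma metric_1_4_einstein (z v u w : R) : einstein_weights_1_4 n z v u w ->
  invariant_metric (@metric_1_4 R n z v u w) /\ einstein (@metric_1_4 R n z v u w).
Proof.
case=> -[z0 v0 u0 w0] [mu ric]; set W := block_weight _ _ _ _ _ in ric.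
apply: (block_einstein (k1 := 1) (k2 := 4) erefl n_gt5
  (And5 ltr01 z0 v0 u0 w0) (mu := mu)); first exact: metric_1_4E.
move=> i k ik; rewrite !(@lower_blk n 1 4) // -/W.
have WC b c : W b c = W c b by exact: block_weightC.
have rC b c : block_ricci n 1 4 W b c = block_ricci n 1 4 W c b.
  exact: block_ricciC.
have : ~~ ((blk 1 4 i == 1%N) && (blk 1 4 k == 1%N)).
  apply: contra ik => /andP[]; rewrite /blk.
  case: (ltnP i 1) => [i0 _|_]; last by case: ifP.
  case: (ltnP k 1) => [j0 _|_]; last by case: ifP.
  by apply/eqP/val_inj; move: i0 j0; rewrite /= !ltnS !leqn0 => /eqP-> /eqP->.
case: (blk_cases 1 4 i) => ->; case: (blk_cases 1 4 k) => -> // _ _;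
  by [exact: ric|rewrite rC WC; exact: ric].
Qed.

Lemma metric_2_3_einstein (y z v u w : R) : einstein_weights_2_3 n y z v u w ->
  invariant_metric (@metric_2_3 R n y z v u w)
  /\ einstein (@metric_2_3 R n y z v u w).
Proof.
case=> x0 [mu ric]; set W := block_weight _ _ _ _ _ in ric.
apply: (block_einstein (k1 := 2) (k2 := 3) erefl n_gt5 x0 (mu := mu));
  first exact: metric_2_3E.
move=> i k ik; rewrite !(@lower_blk n 2 3) // -/W.
have WC b c : W b c = W c b by exact: block_weightC.
have rC b c : block_ricci n 2 3 W b c = block_ricci n 2 3 W c b.
  exact: block_ricciC.
case: (blk_cases 2 3 i) => ->; case: (blk_cases 2 3 k) => -> // _;
  by [exact: ric|rewrite rC WC; exact: ric].
Qed.

(** With blocks of sizes 5, 0 and n - 5, block 2 does not occur and its weights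
    may be anything positive. The equations of so(5) and q reduce to one
    quadratic equation for a. *)
Lemma jensen_einstein (a : R) : 0 < a ->
  (n%:R - 1) * a ^+ 2 - 2 * (n%:R - 2) * a + 3 = 0 ->
  invariant_metric (@jensen_metric R n a) /\ einstein (@jensen_metric R n a).
Proof.
move=> a0 aE; have an : a != 0 by rewrite gt_eqF.
apply: (block_einstein (k1 := 5) (k2 := 0) erefl n_gt5
  (And5 a0 ltr01 ltr01 ltr01 ltr01) (mu := (n%:R - 2) / 2 - a)).
  exact: jensen_metricE.
move=> i k _; rewrite !(@lower_blk n 5 0) //.
have no2 (l : 'I_n) : blk 5 0 l != 2%N.
  by rewrite /blk addn0; case: ifP => // ->.
move: (no2 i) (no2 k).
case: (blk_cases 5 0 i) => ->; case: (blk_cases 5 0 k) => -> // _ _ _;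
  rewrite /block_ricci /block_ricci_term /=.
- apply/eqP; rewrite -subr_eq0; apply/eqP.
  transitivity (((n%:R - 1) * a ^+ 2 - 2 * (n%:R - 2) * a + 3) / 4).
    by field.
  by rewrite aE mul0r.
- by field.
- by field.
Qed.

Lemma jensen_roots : let s := Num.sqrt (n%:R ^+ 2 - 7 * n%:R + 7) : R in
  [/\ 0 < jensen_minus R n, jensen_minus R n < jensen_plus R n
    & forall a, a = jensen_plus R n \/ a = jensen_minus R n ->
      (n%:R - 1) * a ^+ 2 - 2 * (n%:R - 2) * a + 3 = 0].
Proof.
move=> s; have n7 : 7 <= n%:R :> R by rewrite ler_nat.
have D0 : 0 < n%:R ^+ 2 - 7 * n%:R + 7 :> R by nra.
have s0 : 0 < s by rewrite sqrtr_gt0.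
have sE : s ^+ 2 = n%:R ^+ 2 - 7 * n%:R + 7 by rewrite sqr_sqrtr // ltW.
have n1 : 0 < n%:R - 1 :> R by lra.
have n1n : n%:R - 1 != 0 :> R by rewrite gt_eqF.
split.
- rewrite divr_gt0 // -/s; rewrite ltNge; apply/negP => sn; nra.
- by rewrite ltr_pM2r ?invr_gt0 // -/s; lra.
have root (t : R) : t ^+ 2 = s ^+ 2 ->
    let a := (n%:R - 2 + t) / (n%:R - 1) in
    (n%:R - 1) * a ^+ 2 - 2 * (n%:R - 2) * a + 3 = 0.
  move=> tE a; transitivity ((t ^+ 2 - (n%:R ^+ 2 - 7 * n%:R + 7)) / (n%:R - 1)).
    by rewrite /a; field.
  by rewrite tE sE subrr mul0r.
by move=> a [->|->]; [apply: root|apply: root; rewrite sqrrN].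
Qed.

(** Elementary skew matrices of p recover the weights from the metric. *)
Lemma homothetic_weights w1 w2 (Q1 Q2 : 'M[R]_n -> 'M[R]_n -> R) :
  (forall X Y, in_p X -> in_p Y -> Q1 X Y = wform w1 X Y) ->
  (forall X Y, in_p X -> in_p Y -> Q2 X Y = wform w2 X Y) ->
  (forall i j, w1 i j = w1 j i) -> (forall i j, w2 i j = w2 j i) ->
  homothetic Q1 Q2 ->
  exists2 c, c != 0 & forall i j, i != j -> ~~ (lower i && lower j) ->
    w1 i j = c * w2 i j.
Proof.
move=> Q1E Q2E w1C w2C [c c0 Q12]; exists c => [|i j ij lij]; first by rewrite gt_eqF.
have pE : in_p (skew_delta R i j).
  apply/(in_pP _ n_gt2); split; first exact: skew_delta_skew.
  move=> a b lab; rewrite !mxE.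
  have [/andP[/eqP ai /eqP bj]|_] := boolP ((a == i) && (b == j)).
    by move: lij; rewrite -ai -bj lab.
  have [/andP[/eqP aj /eqP bi]|_] := boolP ((a == j) && (b == i)).
    by move: lij; rewrite -aj -bi andbC lab.
  by rewrite subrr.
have n2 : n%:R - 2 != 0 :> R by rewrite subr_eq0 eqr_nat gtn_eqF.
have wE (w : 'I_n -> 'I_n -> R) : (forall i j, w i j = w j i) ->
    wform w (skew_delta R i j) (skew_delta R i j) = (n%:R - 2) * 2 * w i j.
  move=> wC; rewrite /wform -mulrA; congr (_ * _).
  transitivity (\sum_a \sum_b ((w a b * (a == i)%:R) * (b == j)%:R
       + (w a b * (a == j)%:R) * (b == i)%:R)).
    apply: eq_bigr => a _; apply: eq_bigr => b _; rewrite !mxE.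
    have [->|ai] /= := eqVneq a i.
      rewrite (negPf ij) /=; case: (b == j); rewrite ?mulr1n ?mulr0n; ring.
    have [->|aj] /= := eqVneq a j; case: (b == i); rewrite ?mulr1n ?mulr0n; ring.
  transitivity (\sum_a (w a j * (a == i)%:R + w a i * (a == j)%:R)).
    apply: eq_bigr => a _; rewrite big_split /= !sum_delta //.
  by rewrite big_split /= !sum_delta (wC j i); ring.
have := Q12 _ _ pE pE; rewrite Q1E // Q2E // !wE // => e.
apply: (mulfI (_ : (n%:R - 2) * 2 != 0)); first by rewrite mulf_neq0 ?pnatr_eq0.
by rewrite e; ring.
Qed.

End Metrics.

Lemma two_solutions_1_4 (R : realType) (n : nat) : (6 < n)%N ->
  (exists z v u w : R, einstein_weights_1_4 n z v u w /\ u < w) /\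
  (exists z v u w : R, einstein_weights_1_4 n z v u w /\ w < u).
Proof.
move=> n6; have m2 : 2 <= n%:R - 5 :> R.
  have : 7 <= n%:R :> R by rewrite ler_nat.
  by lra.
split.
  have [u [v [w [F0 G0 /and5P[M0 u0 v0 w0 /andP[uw _]]]]]] :=
    certified_zero m2 certificate_1_4_lt.
  have G0' := interp_opp_eq0 G0.
  have [z zE] := system_1_4 n6 u0 v0 w0 F0 G0' M0.
  by exists z, v, u, w; split; rewrite -1?subr_gt0.
have [u [v [w [F0 G0 /and5P[M0 u0 v0 w0 /andP[uw _]]]]]] :=
  certified_zero m2 certificate_1_4_gt.
have F0' := interp_opp_eq0 F0.
have [z zE] := system_1_4 n6 u0 v0 w0 F0' G0 M0.
by exists z, v, u, w; split; rewrite -1?subr_gt0.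
Qed.

Lemma two_solutions_2_3 (R : realType) (n : nat) : (6 < n)%N ->
  (exists y z v u w : R, einstein_weights_2_3 n y z v u w /\ u < w) /\
  (exists y z v u w : R, einstein_weights_2_3 n y z v u w /\ w < u).
Proof.
move=> n6; have m2 : 2 <= n%:R - 5 :> R.
  have : 7 <= n%:R :> R by rewrite ler_nat.
  by lra.
split.
  have [u [v [w [F0 G0 /and5P[T0 u0 v0 w0 /andP[uw _]]]]]] :=
    certified_zero m2 certificate_2_3_lt.
  have G0' := interp_opp_eq0 G0.
  have [y [z yzE]] := system_2_3 n6 u0 v0 w0 F0 G0' T0.
  by exists y, z, v, u, w; split; rewrite -1?subr_gt0.
have [u [v [w [F0 G0 /and5P[T0 u0 v0 w0 /andP[uw _]]]]]] :=
  certified_zero m2 certificate_2_3_gt.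
have F0' := interp_opp_eq0 F0.
have [y [z yzE]] := system_2_3 n6 u0 v0 w0 F0' G0 T0.
by exists y, z, v, u, w; split; rewrite -1?subr_gt0.
Qed.

Theorem theorem4p3 (R : realType) (n : nat) (hn : (7 <= n)%N) :
  exists g : 'I_6 -> 'M[R]_n -> 'M[R]_n -> R,
    (forall k, invariant_metric (g k) /\ einstein (g k)) /\
    (forall k l, k != l -> ~ homothetic (g k) (g l)) /\
    g (inord 0) = jensen_metric (jensen_plus R n) /\
    g (inord 1) = jensen_metric (jensen_minus R n) /\
    (forall k : 'I_6, (2 <= k <= 3)%N ->
       Ad_invariant (in_block_SO 1 4) (g k) /\
       exists x2 x12 x13 x23 : R,
         [/\ 0 < x2, 0 < x12, 0 < x13 & 0 < x23] /\
         g k = metric_1_4 x2 x12 x13 x23) /\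
    (forall k : 'I_6, (4 <= k <= 5)%N ->
       Ad_invariant (in_block_SO 2 3) (g k) /\
       exists x1 x2 x12 x13 x23 : R,
         [/\ 0 < x1, 0 < x2, 0 < x12, 0 < x13 & 0 < x23] /\
         g k = metric_2_3 x1 x2 x12 x13 x23).
Proof.
have [am0 amp aE] := jensen_roots R hn.
have ap0 := lt_trans am0 amp.
have [[z1 [v1 [u1 [w1 [E1 uw1]]]]] [z2 [v2 [u2 [w2 [E2 uw2]]]]]] :=
  two_solutions_1_4 R hn.
have [[y3 [z3 [v3 [u3 [w3 [E3 uw3]]]]]] [y4 [z4 [v4 [u4 [w4 [E4 uw4]]]]]]] :=
  two_solutions_2_3 R hn.
have [[z10 v10 u10 w10] _] := E1; have [[z20 v20 u20 w20] _] := E2.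
have [[y30 z30 v30 u30 w30] _] := E3; have [[y40 z40 v40 u40 w40] _] := E4.
pose W : seq ('I_n -> 'I_n -> R) :=
  [:: blk_weight 5 0 (jensen_plus R n) 1 1 1 1;
      blk_weight 5 0 (jensen_minus R n) 1 1 1 1;
      blk_weight 1 4 1 z1 v1 u1 w1; blk_weight 1 4 1 z2 v2 u2 w2;
      blk_weight 2 3 y3 z3 v3 u3 w3; blk_weight 2 3 y4 z4 v4 u4 w4].
pose g (k : 'I_6) : 'M[R]_n -> 'M[R]_n -> R := nth (jensen_metric 0)
  [:: jensen_metric (jensen_plus R n); jensen_metric (jensen_minus R n);
      metric_1_4 z1 v1 u1 w1; metric_1_4 z2 v2 u2 w2;
      metric_2_3 y3 z3 v3 u3 w3; metric_2_3 y4 z4 v4 u4 w4] k.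
have gE k X Y : in_p X -> in_p Y ->
    g k X Y = wform (nth (fun _ _ => 0) W k) X Y.
  case: k => [[|[|[|[|[|[|//]]]]]] ?] pX pY; rewrite /g /W /=;
    [exact: jensen_metricE|exact: jensen_metricE|exact: metric_1_4E
    |exact: metric_1_4E|exact: metric_2_3E|exact: metric_2_3E].
have WC (k : 'I_6) i j : nth (fun _ _ => 0) W k i j = nth (fun _ _ => 0) W k j i.
  by case: k => [[|[|[|[|[|[|//]]]]]] ?]; apply: block_weightC.
exists g; split; [|split; [|split; [|split; [|split]]]].
- case=> [[|[|[|[|[|[|//]]]]]] ?]; rewrite /g /=.
  + by apply: jensen_einstein => //; apply: aE; left.
  + by apply: jensen_einstein => //; apply: aE; right.
  + exact: metric_1_4_einstein E1.
  + exact: metric_1_4_einstein E2.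
  + exact: metric_2_3_einstein E3.
  + exact: metric_2_3_einstein E4.
- move=> k l kl /(homothetic_weights hn (gE k) (gE l) (WC k) (WC l)) [c c0 ratio].
  (* The ratios of the weights of the edges (0,5) and (1,5) to that of (2,5)
     tell the metrics apart: both are 1 for Jensen's metrics, only the second
     is 1 for the blocks (1,4,n-5), and none for (2,3,n-5); on which side of 1
     they are depends on whether u < w. Jensen's two metrics differ in the
     weight of (0,1). *)
  pose o0 : 'I_n := Ordinal (leq_trans (isT : 0 < 7)%N hn).
  pose o1 : 'I_n := Ordinal (leq_trans (isT : 1 < 7)%N hn).
  pose o2 : 'I_n := Ordinal (leq_trans (isT : 2 < 7)%N hn).
  pose o5 : 'I_n := Ordinal (leq_trans (isT : 5 < 7)%N hn).
  pose r (k : 'I_6) (i j : 'I_n) :=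
    nth (fun _ _ => 0) W k i j / nth (fun _ _ => 0) W k o2 o5.
  have rE i j : i != j -> ~~ (lower i && lower j) -> r k i j = r l i j.
    move=> ij lij; rewrite /r (ratio i j) // (ratio o2 o5) //.
    by rewrite -mulf_div divff // mul1r.
  have u1w1 : u1 / w1 < 1 by rewrite ltr_pdivrMr // mul1r.
  have u2w2 : 1 < u2 / w2 by rewrite ltr_pdivlMr // mul1r.
  have u3w3 : u3 / w3 < 1 by rewrite ltr_pdivrMr // mul1r.
  have u4w4 : 1 < u4 / w4 by rewrite ltr_pdivlMr // mul1r.
  have r05 j : r j o0 o5 = nth 0 [:: 1; 1; u1 / w1; u2 / w2; u3 / w3; u4 / w4] j.
    rewrite /r /W /blk_weight /blk.
    by case: j => [[|[|[|[|[|[|//]]]]]] ?]; rewrite /= ?divr1 ?divff ?gt_eqF.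
  have r15 j : r j o1 o5 = nth 0 [:: 1; 1; 1; 1; u3 / w3; u4 / w4] j.
    rewrite /r /W /blk_weight /blk.
    by case: j => [[|[|[|[|[|[|//]]]]]] ?]; rewrite /= ?divr1 ?divff ?gt_eqF.
  have r01 (j : 'I_6) : (j < 2)%N ->
      r j o0 o1 = nth 0 [:: jensen_plus R n; jensen_minus R n] j.
    rewrite /r /W /blk_weight /blk.
    by case: j => [[|[|[|[|[|[|//]]]]]] ?]; rewrite /= ?divr1.
  have := rE o0 o5 isT isT; have := rE o1 o5 isT isT.
  have := rE o0 o1 isT isT; rewrite !r05 !r15.
  case: (ltnP k 2) => [k2|]; case: (ltnP l 2) => [l2|].
  + rewrite !r01 //; move: kl k2 l2; clear -amp.
    by case: k l => [[|[|//]] ?] [[|[|//]] ?] //= _ _ _; lra.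
  + move=> l2 _; move: l2 k2; clear -u1w1 u2w2 u3w3 u4w4.
    by case: k l => [[|[|//]] ?] [[|[|[|[|[|[|//]]]]]] ?] //= _ _; lra.
  + move=> k2 _; move: l2 k2; clear -u1w1 u2w2 u3w3 u4w4.
    by case: l k => [[|[|//]] ?] [[|[|[|[|[|[|//]]]]]] ?] //= _ _; lra.
  move=> l2 k2 _; move: kl l2 k2; clear -u1w1 u2w2 u3w3 u4w4.
  by case: k l => [[|[|[|[|[|[|//]]]]]] ?] [[|[|[|[|[|[|//]]]]]] ?] //= _ _ _; lra.
- by rewrite /g inordK.
- by rewrite /g inordK.
- case=> [[|[|[|[|//]]]] ?] // _; split.
  + exact: (block_SO_invariant hn _ (And5 ltr01 z10 v10 u10 w10)
      (@metric_1_4E R n hn 1 z1 v1 u1 w1)).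
  + by exists z1, v1, u1, w1.
  + exact: (block_SO_invariant hn _ (And5 ltr01 z20 v20 u20 w20)
      (@metric_1_4E R n hn 1 z2 v2 u2 w2)).
  + by exists z2, v2, u2, w2.
- case=> [[|[|[|[|[|[|//]]]]]] ?] // _; split.
  + exact: (block_SO_invariant hn _ (And5 y30 z30 v30 u30 w30)
      (@metric_2_3E R n hn y3 z3 v3 u3 w3)).
  + by exists y3, z3, v3, u3, w3.
  + exact: (block_SO_invariant hn _ (And5 y40 z40 v40 u40 w40)
      (@metric_2_3E R n hn y4 z4 v4 u4 w4)).
  + by exists y4, z4, v4, u4, w4.
Qed.
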